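(* Let $\mathbb{K}$ be a field and let $G$ be a finite simple Cameron-Walker graph. Then for every integer $k\geq 1$, $${\rm reg}(J(G)^{(k)})=k\,{\rm deg}(J(G)).$$
   Context: For $V(G)=\{x_1,\ldots,x_n\}$, let $S=\mathbb{K}[x_1,\ldots,x_n]$. The cover ideal is $J(G)=\bigcap_{x_ix_j\in E(G)}(x_i,x_j)$ and its $k$-th symbolic power is $J(G)^{(k)}=\bigcap_{x_ix_j\in E(G)}(x_i,x_j)^k$ (both equal $S$ if $G$ has no edges). The regularity of a graded $S$-module $M$ is ${\rm reg}(M)=\max\{j-i\mid \beta_{i,j}(M)\neq 0\}$. For a monomial ideal $I$, ${\rm deg}(I)$ is the maximum degree of its minimal monomial generators; thus ${\rm deg}(J(G))$ is the largest cardinality of a minimal vertex cover of $G$. A matching of $G$ is a set of pairwise disjoint edges; a matching $M$ is induced if for every pair $e,e'\in M$ there is no edge $f\in E(G)\setminus M$ with $f\subset e\cup e'$. $G$ is a Cameron-Walker graph if the largest cardinality of a matching of $G$ equals the largest cardinality of an induced matching of $G$. *)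

(* Defs.v *)
From HB Require Import structures.
From mathcomp Require Import all_boot all_order all_algebra.
From mathcomp Require Import mpoly.

Set Implicit Arguments.
Unset Strict Implicit.
Unset Printing Implicit Defensive.

Import GRing.Theory.
Local Open Scope ring_scope.

(** Ideals are [Prop]-valued predicates on the ring. *)

Definition ideal_span (R : comNzRingType) (P : R -> Prop) (f : R) : Prop :=
  exists (m : nat) (a g : 'I_m -> R),
    (forall i, P (g i)) /\ f = \sum_(i < m) a i * g i.

Definition ideal_mul (R : comNzRingType) (I J : R -> Prop) : R -> Prop :=
  ideal_span (fun h => exists f g, [/\ I f, J g & h = f * g]).

Fixpoint ideal_pow (R : comNzRingType) (I : R -> Prop) (k : nat) : R -> Prop :=
  if k is k'.+1 then ideal_mul I (ideal_pow I k') else fun _ => True.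

Definition edges (n : nat) (adj : rel 'I_n) : {set {set 'I_n}} :=
  [set f | [exists i, exists j, adj i j && (f == [set i; j])]].

Definition matching (n : nat) (adj : rel 'I_n) (M : {set {set 'I_n}}) : bool :=
  (M \subset edges adj) && trivIset M.

Definition induced_matching (n : nat) (adj : rel 'I_n)
    (M : {set {set 'I_n}}) : bool :=
  matching adj M &&
  [forall e in M, forall e' in M,
     ~~ [exists f in edges adj :\: M, f \subset e :|: e']].

Definition matching_number (n : nat) (adj : rel 'I_n) : nat :=
  \max_(M : {set {set 'I_n}} | matching adj M) #|M|.

Definition induced_matching_number (n : nat) (adj : rel 'I_n) : nat :=
  \max_(M : {set {set 'I_n}} | induced_matching adj M) #|M|.

Definition cameron_walker (n : nat) (adj : rel 'I_n) : Prop :=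
  matching_number adj = induced_matching_number adj.

Definition edge_prime (K : fieldType) (n : nat) (i j : 'I_n) :
    {mpoly K[n]} -> Prop :=
  ideal_span (fun p => p = 'X_i \/ p = 'X_j).

Definition cover_ideal (K : fieldType) (n : nat) (adj : rel 'I_n)
    (p : {mpoly K[n]}) : Prop :=
  forall i j, adj i j -> edge_prime i j p.

Definition cover_ideal_sympow (K : fieldType) (n : nat) (adj : rel 'I_n)
    (k : nat) (p : {mpoly K[n]}) : Prop :=
  forall i j, adj i j -> ideal_pow (edge_prime i j) k p.

Definition monomial_span (K : fieldType) (n : nat) (P : 'X_{1..n} -> Prop) :
    {mpoly K[n]} -> Prop :=
  ideal_span (fun p => exists2 m, P m & p = 'X_[m]).

Definition minimal_monomial_generators (K : fieldType) (n : nat)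
    (I : {mpoly K[n]} -> Prop) (G : seq 'X_{1..n}) : Prop :=
  (forall p, I p <-> monomial_span (fun m => m \in G) p) /\
  (forall m, m \in G ->
     ~ @monomial_span K n (fun m' => m' \in G /\ m' <> m) 'X_[m]).

Definition has_deg (K : fieldType) (n : nat) (I : {mpoly K[n]} -> Prop)
    (d : nat) : Prop :=
  exists2 G : seq 'X_{1..n},
    minimal_monomial_generators I G & d = \max_(m <- G) mdeg m.

(** [F_i] is the free module of row vectors of length [fr_rank i], whose [a]-th
    basis vector has degree [fr_shift i a], i.e. the direct sum of the
    [S(- fr_shift i a)].  Matrices act on the right: [fr_diff i] is the map
    [F_(i+1) -> F_i] and [fr_aug] is the map [F_0 -> S].  Natural number
    shifts suffice, since ideals of [S] live in nonnegative degrees. *)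
Record free_complex (K : fieldType) (n : nat) := FreeComplex {
  fr_rank  : nat -> nat;
  fr_shift : forall i : nat, 'I_(fr_rank i) -> nat;
  fr_aug   : 'cV[{mpoly K[n]}]_(fr_rank 0);
  fr_diff  : forall i : nat, 'M[{mpoly K[n]}]_(fr_rank i.+1, fr_rank i)
}.

(** Maps are homogeneous of degree 0: a nonzero entry sending a basis vector of
    degree [s] to one of degree [t] is a form of degree [s - t]. *)
Definition fr_graded (K : fieldType) (n : nat) (F : free_complex K n) : Prop :=
  (forall a m, m \in msupp (fr_aug F a 0) -> mdeg m = fr_shift a) /\
  (forall i (a : 'I_(fr_rank F i.+1)) (b : 'I_(fr_rank F i)) m,
     m \in msupp (fr_diff F i a b) -> (mdeg m + fr_shift b)%N = fr_shift a).

Definition fr_exact (K : fieldType) (n : nat) (I : {mpoly K[n]} -> Prop)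
    (F : free_complex K n) : Prop :=
  [/\ forall p, I p <-> exists v : 'rV_(fr_rank F 0), (v *m fr_aug F) 0 0 = p,
      forall v : 'rV_(fr_rank F 0),
        v *m fr_aug F = 0 <-> exists w, v = w *m fr_diff F 0
    & forall i (v : 'rV_(fr_rank F i.+1)),
        v *m fr_diff F i = 0 <-> exists w, v = w *m fr_diff F i.+1].

(** Minimality: the image of [F_(i+1)] lies in [(x_1, ..., x_n) F_i], i.e. no
    matrix entry has a constant term. *)
Definition fr_minimal (K : fieldType) (n : nat) (F : free_complex K n) : Prop :=
  forall i (a : 'I_(fr_rank F i.+1)) (b : 'I_(fr_rank F i)),
    (fr_diff F i a b)@_0%MM = 0.

Definition minimal_free_resolution (K : fieldType) (n : nat)
    (I : {mpoly K[n]} -> Prop) (F : free_complex K n) : Prop :=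
  [/\ fr_graded F, fr_exact I F & fr_minimal F].

(** The value is unambiguous because minimal graded free resolutions are unique
    up to isomorphism. *)
Definition is_betti (K : fieldType) (n : nat) (I : {mpoly K[n]} -> Prop)
    (i j b : nat) : Prop :=
  exists2 F : free_complex K n, minimal_free_resolution I F
    & b = #|[set a : 'I_(fr_rank F i) | fr_shift a == j]|.

Definition has_reg (K : fieldType) (n : nat) (I : {mpoly K[n]} -> Prop)
    (r : int) : Prop :=
  (exists i j b, [/\ is_betti I i j b, b <> 0%N & j%:Z - i%:Z = r]) /\
  (forall i j b, is_betti I i j b -> b <> 0%N -> j%:Z - i%:Z <= r).

(* Main.v *)
Require Import Defs.
From Stdlib Require Import Classical ClassicalEpsilon.
From mathcomp Require Import all_boot all_order all_algebra.
From mathcomp Require Import mpoly zify.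

(** A monomial [X^m] lies in the [k]-th symbolic power of the cover ideal iff
    [k <= m i + m j] on every edge [ij].  The argument works with the larger
    family of ideals [I_w] in which the bound is a weight [w i j] depending on
    the edge, because that family is stable under the two operations which drive
    the induction: the colon by a variable [x_v], and the elimination of [x_v].

    Put [I2 = I : x_v], and let [I1] be generated by the monomials of [I] free of
    [x_v].  Then [I = x_v I2 + I1] and [x_v I2] meets [I1] in [x_v I1], so a
    mapping cone turns resolutions of [I2] and [I1] into one of [I]
    ([cone_exact]).  If no minimal generator of [I2] lies in [I], the minimal
    generators of [I] account for those of [I2] (times [x_v]) and of [I1], and so
    every shift of the cone in homological degree [i] is at most [i] plus the
    degree of some minimal generator of [I] ([bounded_res_split]).  Such a [v]
    exists as soon as some edge [uv] of positive weight satisfies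
    [w u j <= w v j] for all [j <> v] ([sheds_mingen]).

    In a Cameron-Walker graph a maximum matching can be taken induced.  Its
    unmatched vertices are independent, and each matched edge either has a leaf
    end or forms a triangle with a single unmatched vertex
    ([cameron_walker_shape]).  With this structure a shedding vertex is always
    available: the neighbour of a leaf, then a corner of a triangle, then an
    unmatched vertex ([cw_weight_sheds]).  Hence the symbolic powers have a graded
    free resolution whose shifts are bounded by generator degrees
    ([bounded_res_cw]), and the shifts of a minimal resolution are among those
    of any other one ([comparison]).

    What remains is the largest degree of a minimal generator.  Powers of
    generators of the cover ideal give [k * d] as a lower bound
    ([mingen_scale]).  Conversely, rounding a minimal generator at the [k]
    possible thresholds gives [k] minimal vertex covers whose sizes add up to at
    least its degree ([mingen_degree]).

    Minimal resolutions exist because submodules of free modules over the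
    polynomial ring are finitely generated ([submod_fgen],
    [minimal_resolution_exists]). *)

Set Implicit Arguments.
Unset Strict Implicit.
Unset Printing Implicit Defensive.

Import Order.TTheory GRing.Theory Num.Theory.
Local Open Scope ring_scope.

(** * Supports of polynomials and homogeneous matrices *)

Section Support.
Variables (K : fieldType) (n : nat).
Implicit Types (A B C : pred 'X_{1..n}) (p q : {mpoly K[n]}).

(** Membership in a monomial ideal and homogeneity are both conditions on the
    support, hence this common form. *)
Definition supported A p : Prop := forall m, m \in msupp p -> A m.

Lemma sub_supported A B p : subpred A B -> supported A p -> supported B p.
Proof. by move=> sAB hp m /hp/sAB. Qed.

Lemma supported0 A : supported A 0.
Proof. by move=> m; rewrite -mpolyC0 msupp0. Qed.

Lemma supportedD A p q : supported A p -> supported A q -> supported A (p + q).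
Proof. by move=> hp hq m /msuppD_le; rewrite mem_cat => /orP[/hp|/hq]. Qed.

Lemma supportedN A p : supported A p -> supported A (- p).
Proof. by move=> hp m; rewrite (perm_mem (msuppN p)) => /hp. Qed.

Lemma supported_sum A (I : Type) (r : seq I) (F : I -> {mpoly K[n]}) :
  (forall i, supported A (F i)) -> supported A (\sum_(i <- r) F i).
Proof.
by move=> hF; elim/big_rec: _ => [|i p _]; [exact: supported0 | exact: supportedD].
Qed.

Lemma supportedM A B C p q : supported A p -> supported B q ->
  (forall m1 m2, A m1 -> B m2 -> C (m1 + m2)%MM) -> supported C (p * q).
Proof. by move=> hp hq hC m /msuppM_le/allpairsP[[m1 m2] /= [/hp ? /hq ? ->]]; exact: hC. Qed.

Lemma supportedX A m : supported A ('X_[m] : {mpoly K[n]}) <-> A m.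
Proof.
split=> [h|hm m']; first by apply: h; apply/mem_msuppXP.
by move/mem_msuppXP=> <-.
Qed.

Definition mpart A p : {mpoly K[n]} := \sum_(m <- msupp p | A m) p@_m *: 'X_[m].

Lemma mcoeff_mpart A p m : (mpart A p)@_m = if A m then p@_m else 0.
Proof.
rewrite /mpart raddf_sum /=; case: (boolP (m \in msupp p)) => hm; last first.
  rewrite (memN_msupp_eq0 hm) if_same big_seq_cond big1 // => m' /andP[hm' _].
  rewrite mcoeffZ mcoeffX; case: eqP => [e|_]; last by rewrite mulr0.
  by rewrite -e hm' in hm.
rewrite big_mkcond (bigD1_seq m) ?msupp_uniq //= big1 => [|m' ne]; last first.
  by case: ifP => // _; rewrite mcoeffZ mcoeffX (negbTE ne) mulr0.
by case: ifP; rewrite addr0 // mcoeffZ mcoeffX eqxx mulr1.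
Qed.

Lemma eq_mpart A B p : A =1 B -> mpart A p = mpart B p.
Proof. by move=> eAB; apply/mpolyP=> m; rewrite !mcoeff_mpart eAB. Qed.

Lemma mpartD A p q : mpart A (p + q) = mpart A p + mpart A q.
Proof.
apply/mpolyP=> m; rewrite mcoeffD !mcoeff_mpart mcoeffD.
by case: ifP; rewrite ?addr0.
Qed.

Lemma mpart0 A : mpart A 0 = 0.
Proof. by apply/mpolyP=> m; rewrite mcoeff_mpart mcoeff0 if_same. Qed.

Lemma supported_mpart A p : supported A (mpart A p).
Proof.
by move=> m; rewrite mcoeff_msupp mcoeff_mpart; case: ifP => //; rewrite eqxx.
Qed.

Lemma mpart_id A p : supported A p -> mpart A p = p.
Proof.
move=> hp; apply/mpolyP=> m; rewrite mcoeff_mpart; case: ifPn => // hm.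
by rewrite memN_msupp_eq0 //; apply: contra hm => /hp.
Qed.

Lemma mpart_eq0 A p : supported (predC A) p -> mpart A p = 0.
Proof.
move=> hp; apply/mpolyP=> m; rewrite mcoeff_mpart mcoeff0; case: ifP => // hm.
by rewrite memN_msupp_eq0 //; apply/negP=> /hp; rewrite /= hm.
Qed.

Lemma mpart_split A p : p = mpart A p + mpart (predC A) p.
Proof.
apply/mpolyP=> m; rewrite mcoeffD !mcoeff_mpart /=.
by case: (A m); rewrite ?addr0 ?add0r.
Qed.

(** The complement of the [A]-part of [p] contributes to [p * q] only monomials
    outside [C], so the two truncations agree. *)
Lemma mpartM A B C p q : supported B q ->
  (forall m1 m2, B m2 -> C (m1 + m2)%MM = A m1) ->
  mpart C (p * q) = mpart A p * q.
Proof.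
move=> hq hC; rewrite {1}(mpart_split A p) mulrDl mpartD.
rewrite (@mpart_id C (_ * _)); last first.
  by apply: (supportedM (@supported_mpart (A) _) hq) => m1 m2 ? /hC ->.
rewrite (@mpart_eq0 C (_ * _)) ?addr0 //.
by apply: (supportedM (@supported_mpart (predC A) _) hq) => m1 m2 /= ? /hC ->.
Qed.

End Support.

Section Graded.
Variables (K : fieldType) (n : nat).
Local Notation S := {mpoly K[n]}.

(** The matrices of the degree 0 maps from the free module with shifts [s] to the
    one with shifts [t].  A homogeneous vector of degree [e] is the one-row case in
    which [s] is constantly [e]. *)
Definition hommx p q (s : 'I_p -> nat) (t : 'I_q -> nat) (D : 'M[S]_(p, q)) :=
  forall a b, supported (fun m => mdeg m + t b == s a)%N (D a b).

Lemma hommx_mul p q r (s : 'I_p -> nat) (t : 'I_q -> nat) (u : 'I_r -> nat)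
    (A : 'M[S]_(p, q)) (B : 'M[S]_(q, r)) :
  hommx s t A -> hommx t u B -> hommx s u (A *m B).
Proof.
move=> hA hB a b; rewrite mxE; apply: supported_sum => c.
apply: (supportedM (hA a c) (hB c b)) => m1 m2 /eqP <- /eqP <-.
by rewrite mdegD addnA.
Qed.

Definition hpart q (t : 'I_q -> nat) (e : nat) (v : 'rV[S]_q) : 'rV[S]_q :=
  \row_b mpart (fun m => mdeg m + t b == e)%N (v 0 b).

Lemma hommx_hpart q (t : 'I_q -> nat) e v :
  hommx (fun _ => e) t (hpart t e v).
Proof. by move=> a b; rewrite mxE; exact: supported_mpart. Qed.

Lemma hpart_id q (t : 'I_q -> nat) e v : hommx (fun _ => e) t v -> hpart t e v = v.
Proof. by move=> hv; apply/rowP=> b; rewrite mxE mpart_id //; exact: hv. Qed.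

Lemma hpart0 q (t : 'I_q -> nat) e : hpart t e 0 = 0.
Proof. by apply/rowP=> b; rewrite !mxE mpart0. Qed.

Lemma hpart_mul q r (t : 'I_q -> nat) (u : 'I_r -> nat) (D : 'M[S]_(q, r)) e v :
  hommx t u D -> hpart u e (v *m D) = hpart t e v *m D.
Proof.
move=> hD; apply/rowP=> c; rewrite !mxE.
have mS I (s : seq I) (F : I -> S) A : mpart A (\sum_(i <- s) F i) = \sum_(i <- s) mpart A (F i).
  by elim/big_rec2: _ => [|i x y _ <-]; rewrite ?mpart0 ?mpartD.
rewrite mS; apply: eq_bigr => b _; rewrite mxE.
by apply: mpartM (hD b c) _ => m1 m2 /eqP <-; rewrite mdegD addnA.
Qed.

Lemma hpart_sum q (t : 'I_q -> nat) v :
  exists N, forall k, (N <= k)%N -> v = \sum_(e < k) hpart t e v.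
Proof.
exists (\max_b (msize (v 0%R b) + t b))%N => k hk; apply/rowP=> b.
rewrite summxE; apply/mpolyP=> m; rewrite raddf_sum /=.
case: (boolP (m \in msupp (v 0 b))) => hm; last first.
  rewrite (memN_msupp_eq0 hm) big1 // => e _.
  by rewrite mxE mcoeff_mpart (memN_msupp_eq0 hm) if_same.
have lt : (mdeg m + t b < k)%N.
  apply: leq_trans (leq_trans (leq_bigmax b) hk).
  by rewrite ltn_add2r msize_mdeg_lt.
rewrite (bigD1 (Ordinal lt)) //= mxE mcoeff_mpart eqxx big1 ?addr0 // => e ne.
rewrite mxE mcoeff_mpart; case: eqP => // E; case/eqP: ne; exact/val_inj.
Qed.

(** Each row is lifted separately; replacing a lift by its homogeneous part
    keeps it a lift because [B] preserves degrees. *)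
Lemma homog_lift p q r (s : 'I_p -> nat) (t : 'I_q -> nat) (u : 'I_r -> nat)
    (A : 'M[S]_(p, r)) (B : 'M[S]_(q, r)) :
  hommx s u A -> hommx t u B ->
  (forall v : 'rV_p, exists w : 'rV_q, v *m A = w *m B) ->
  exists2 C : 'M[S]_(p, q), hommx s t C & A = C *m B.
Proof.
move=> hA hB hAB.
have /fin_all_exists[f hf] : forall a, exists w : 'rV_q,
    hommx (fun _ => s a) t w /\ row a A = w *m B.
  move=> a; have [w hw] := hAB (delta_mx 0 a).
  exists (hpart t (s a) w); split; first exact: hommx_hpart.
  rewrite -(hpart_mul _ _ hB) -hw -rowE hpart_id // => i b.
  by rewrite mxE; exact: hA.
exists (\matrix_a f a) => [a b|].
  by rewrite mxE; case: (hf a) => h _; exact: h.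
by apply/row_matrixP=> a; rewrite row_mul rowK; case: (hf a).
Qed.

Lemma mx_lift p q r (A : 'M[S]_(p, r)) (B : 'M[S]_(q, r)) :
  (forall v : 'rV_p, exists w : 'rV_q, v *m A = w *m B) -> exists C : 'M[S]_(p, q), A = C *m B.
Proof.
move=> hAB; have /fin_all_exists[f hf] : forall a, exists w : 'rV_q, row a A = w *m B.
  by move=> a; have [w] := hAB (delta_mx 0 a); rewrite -rowE; exists w.
by exists (\matrix_a f a); apply/row_matrixP=> a; rewrite row_mul rowK.
Qed.

End Graded.

(** * The shifts of a minimal resolution occur in every resolution *)

Section Compare.
Variables (K : fieldType) (n : nat).
Local Notation S := {mpoly K[n]}.

Definition cst0 p q (D : 'M[S]_(p, q)) := forall a b, (D a b)@_0%MM = 0.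

Lemma cst0_mull p q r (A : 'M[S]_(p, q)) (B : 'M[S]_(q, r)) :
  cst0 B -> cst0 (A *m B).
Proof.
move=> hB a b; rewrite mxE raddf_sum big1 // => c _ /=.
by rewrite rmorphM /= hB mulr0.
Qed.

Lemma cst0_mulr p q r (A : 'M[S]_(p, q)) (B : 'M[S]_(q, r)) :
  cst0 A -> cst0 (A *m B).
Proof.
move=> hA a b; rewrite mxE raddf_sum big1 // => c _ /=.
by rewrite rmorphM /= hA mul0r.
Qed.

Lemma cst0D p q (A B : 'M[S]_(p, q)) : cst0 A -> cst0 B -> cst0 (A + B).
Proof. by move=> hA hB a b; rewrite mxE mcoeffD hA hB addr0. Qed.

(** A diagonal entry of [phi *m psi] has constant term 1, so some
    [phi a b] has a nonzero constant term; as [phi a b] is a form of degree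
    [s a - t b], the two shifts agree. *)
Lemma shift_in_retract p q (s : 'I_p -> nat) (t : 'I_q -> nat)
    (phi : 'M[S]_(p, q)) (psi : 'M[S]_(q, p)) :
  hommx s t phi -> cst0 (phi *m psi - 1%:M) -> forall a, exists b, t b = s a.
Proof.
move=> hphi h a; apply: NNPP => no.
have /eqP := h a a; rewrite !mxE mcoeffB eqxx mcoeff1 eqxx subr_eq0.
rewrite raddf_sum big1 /= ?(eq_sym 0) ?oner_eq0 // => b _.
rewrite rmorphM /= (_ : (phi a b)@_0%MM = 0) ?mul0r //.
apply: memN_msupp_eq0; apply/negP => /hphi; rewrite mdeg0 add0n => /eqP e.
by apply: no; exists b.
Qed.

Lemma hommx_aug (F : free_complex K n) : fr_graded F ->
  hommx (@fr_shift _ _ F 0) (fun _ => 0%N) (fr_aug F).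
Proof. by move=> [gF _] a b m; rewrite ord1 => /gF ->; rewrite addn0. Qed.

Lemma hommx_diff (F : free_complex K n) : fr_graded F ->
  forall i, hommx (@fr_shift _ _ F i.+1) (@fr_shift _ _ F i) (fr_diff F i).
Proof. by move=> [_ gF] i a b m /gF/eqP. Qed.

Lemma diff_aug (I : S -> Prop) (F : free_complex K n) :
  fr_exact I F -> fr_diff F 0 *m fr_aug F = 0.
Proof.
move=> [_ x1 _]; apply/row_matrixP=> a; rewrite row_mul row0; apply/x1.
by exists (delta_mx 0 a); rewrite -rowE.
Qed.

Lemma diff_diff (I : S -> Prop) (F : free_complex K n) :
  fr_exact I F -> forall i, fr_diff F i.+1 *m fr_diff F i = 0.
Proof.
move=> [_ _ x2] i; apply/row_matrixP=> a; rewrite row_mul row0; apply/x2.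
by exists (delta_mx 0 a); rewrite -rowE.
Qed.

Variables (I : S -> Prop) (F G : free_complex K n).

(** The identity of the ideal lifts to chain maps [phi : F -> G] and
    [psi : G -> F] whose composite is homotopic to the identity of [F].  Since the
    differentials of [F] have no constant terms, neither has
    [phi *m psi - 1], and [shift_in_retract] applies in each degree. *)
Lemma comparison : minimal_free_resolution I F -> fr_graded G -> fr_exact I G ->
  forall i (a : 'I_(fr_rank F i)), exists b : 'I_(fr_rank G i), fr_shift b = fr_shift a.
Proof.
move=> [gF xF mF] gG xG; have [xF0 xF1 xF2] := xF; have [xG0 xG1 xG2] := xG.
have hF0 := hommx_aug gF; have hG0 := hommx_aug gG.
have hF := hommx_diff gF; have hG := hommx_diff gG.
(* What the next step needs to know about level [i]: both maps carry boundaries to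
   boundaries, and on boundaries [phi *m psi - 1] agrees with [h *m fr_diff F i]. *)
pose inv i := exists (phi : 'M[S]_(fr_rank F i, fr_rank G i))
    (psi : 'M[S]_(fr_rank G i, fr_rank F i)) (h : 'M[S]_(fr_rank F i, fr_rank F i.+1)) X Y,
  [/\ hommx (@fr_shift _ _ F i) (@fr_shift _ _ G i) phi,
      fr_diff F i *m phi = X *m fr_diff G i, fr_diff G i *m psi = Y *m fr_diff F i,
      fr_diff F i *m (phi *m psi - 1%:M) = fr_diff F i *m (h *m fr_diff F i)
    & cst0 (phi *m psi - 1%:M)].
suff hinv i : inv i.
  by move=> i; have [phi [psi [h [X [Y [hphi _ _ _ /(shift_in_retract hphi)]]]]]] := hinv i.
elim: i => [|i [phi [psi [h [X [Y [hphi hX hY hh hc]]]]]]].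
  have aug0 (v : 'rV_(fr_rank F 0)) : exists w, v *m fr_aug F = w *m fr_aug G.
    have /xG0[w hw] : I ((v *m fr_aug F) 0 0) by apply/xF0; exists v.
    by exists w; apply/rowP=> j; rewrite ord1.
  have aug1 (v : 'rV_(fr_rank G 0)) : exists w, v *m fr_aug G = w *m fr_aug F.
    have /xF0[w hw] : I ((v *m fr_aug G) 0 0) by apply/xG0; exists v.
    by exists w; apply/rowP=> j; rewrite ord1.
  have [phi hphi ephi] := homog_lift hF0 hG0 aug0.
  have [psi epsi] := mx_lift aug1.
  have dF := diff_aug xF.
  have dG := diff_aug xG.
  have [X hX] : exists X, fr_diff F 0 *m phi = X *m fr_diff G 0.
    apply: mx_lift => v; apply/xG1.
    by rewrite -!mulmxA -ephi dF mulmx0.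
  have [Y hY] : exists Y, fr_diff G 0 *m psi = Y *m fr_diff F 0.
    apply: mx_lift => v; apply/xF1.
    by rewrite -!mulmxA -epsi dG mulmx0.
  have [h hh] : exists h, phi *m psi - 1%:M = h *m fr_diff F 0.
    apply: mx_lift => v; apply/xF1.
    by rewrite -mulmxA mulmxBl -mulmxA -epsi -ephi mul1mx subrr mulmx0.
  exists phi, psi, h, X, Y; split=> //; first by rewrite hh.
  by rewrite hh; apply: cst0_mull; exact: mF.
have dF := diff_diff xF i.
have dG := diff_diff xG i.
have lif (v : 'rV_(fr_rank F i.+1)) : exists w, v *m (fr_diff F i *m phi) = w *m fr_diff G i.
  by exists (v *m X); rewrite hX mulmxA.
have [phi' hphi' ephi] := homog_lift (hommx_mul (hF i) hphi) (hG i) lif.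
exists phi', Y.
have [X' hX'] : exists X, fr_diff F i.+1 *m phi' = X *m fr_diff G i.+1.
  apply: mx_lift => v; apply/xG2.
  by rewrite -!mulmxA -ephi [X in v *m X]mulmxA dF mul0mx mulmx0.
have [Y' hY'] : exists Y', fr_diff G i.+1 *m Y = Y' *m fr_diff F i.+1.
  apply: mx_lift => v; apply/xF2.
  by rewrite -!mulmxA -hY [X in v *m X]mulmxA dG mul0mx mulmx0.
(* [h'] is the next component of the homotopy. *)
have [h' hh'] : exists h', phi' *m Y - 1%:M - fr_diff F i *m h = h' *m fr_diff F i.+1.
  apply: mx_lift => v; apply/xF2; rewrite -mulmxA.
  rewrite (_ : (phi' *m Y - 1%:M - fr_diff F i *m h) *m fr_diff F i = 0) ?mulmx0 //.
  rewrite mulmxBl -[_ *m h *m _]mulmxA -hh mulmxBr mulmxA ephi -mulmxA hY mulmxBl.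
  by rewrite mul1mx mulmx1 !mulmxA subrr.
have e : phi' *m Y - 1%:M = h' *m fr_diff F i.+1 + fr_diff F i *m h.
  by rewrite -hh' subrK.
exists h', X', Y'; split=> //.
  by rewrite e mulmxDr [X in _ + X]mulmxA dF mul0mx addr0.
by rewrite e; apply: cst0D; [apply: cst0_mull; exact: mF | apply: cst0_mulr; exact: mF].
Qed.

End Compare.

(** * Submodules of free modules are finitely generated *)

Section Noetherian.
Variables (K : fieldType) (n : nat).
Local Notation S := {mpoly K[n]}.

(** Induction on the number [k] of coordinates that are compared.  An exponent
    whose [k]-th coordinate is beyond all those of a finite dominating set for the
    first [k] coordinates is dominated by that set; otherwise its [k]-th coordinate
    takes one of finitely many values, each treated separately. *)
Lemma dickson (P : 'X_{1..n} -> Prop) : exists s : seq 'X_{1..n},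
  (forall m, m \in s -> P m) /\
  forall m, P m -> exists2 m', m' \in s & (m' <= m)%MM.
Proof.
suff {P} H k (P : 'X_{1..n} -> Prop) : exists s : seq 'X_{1..n},
    (forall m, m \in s -> P m) /\
    forall m, P m -> exists2 m', m' \in s & forall i : 'I_n, (i < k)%N -> (m' i <= m i)%N.
  have [s [sP sdom]] := H n P; exists s; split=> // m /sdom[m' ms le].
  by exists m' => //; apply/mnm_lepP=> i; exact: le.
elim: k P => [|k IH] P.
  case: (classic (exists m, P m)) => [[m Pm]|no].
    exists [:: m]; split=> [m'|m' _]; first by rewrite inE => /eqP->.
    by exists m; rewrite ?inE.
  by exists [::]; split=> // m Pm; case: no; exists m.
have [s [sP sdom]] := IH P.
case: (ltnP k n) => kn; last first.
  exists s; split=> // m /sdom[m' ms le]; exists m' => // i _.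
  by apply: le; exact: leq_trans kn.
pose o := Ordinal kn; pose b := \max_(m <- s) m o.
have /fin_all_exists[f hf] (c : 'I_b) : exists t : seq 'X_{1..n},
   (forall m, m \in t -> P m /\ m o = c) /\
   forall m, P m /\ m o = c -> exists2 m', m' \in t & forall i : 'I_n, (i < k)%N -> (m' i <= m i)%N.
  exact: IH.
exists (s ++ flatten (codom f)); split=> [m|m Pm].
  rewrite mem_cat => /orP[/sP//|/flattenP[t /codomP[c ->]]].
  by case: (hf c) => h _ /h[].
case: (ltnP (m o) b) => mb.
  case: (hf (Ordinal mb)) => h1 /(_ m (conj Pm erefl))[m' mt le].
  exists m'.
    rewrite mem_cat; apply/orP; right; apply/flattenP.
    by exists (f (Ordinal mb)); rewrite ?codom_f.
  move=> i; rewrite ltnS leq_eqVlt => /orP[/eqP ik|/le//].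
  have -> : i = o by exact/val_inj.
  by case: (h1 _ mt) => _ ->.
have [m' ms le] := sdom _ Pm; exists m'; first by rewrite mem_cat ms.
move=> i; rewrite ltnS leq_eqVlt => /orP[/eqP ik|/le//].
have -> : i = o by exact/val_inj.
apply: leq_trans mb; exact: (@leq_bigmax_seq _ s xpredT (fun m => m o) m').
Qed.

Definition submodP q (Z : 'rV[S]_q -> Prop) :=
  Z 0 /\ forall a u v, Z u -> Z v -> Z (a *: u + v).

Lemma submod_rowim q r (Z : 'rV[S]_q -> Prop) (D : 'M[S]_(r, q)) (w : 'rV[S]_r) :
  submodP Z -> (forall i, Z (row i D)) -> Z (w *m D).
Proof.
move=> [Z0 ZS] ZD; rewrite mulmx_sum_row.
elim/big_rec: _ => // i v _; exact: ZS.
Qed.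

(** Division by polynomials of the ideal whose leading monomials dominate those of
    all its elements. *)
Lemma ideal_fgen (J : S -> Prop) : J 0 -> (forall a p q, J p -> J q -> J (a * p + q)) ->
  exists (k : nat) (f : 'I_k -> S), (forall i, J (f i)) /\
    forall p, J p -> exists a : 'I_k -> S, p = \sum_i a i * f i.
Proof.
move=> J0 JS.
have [s [sP sdom]] := dickson (fun m => exists f, [/\ J f, f != 0 & mlead f = m]).
have /fin_all_exists[f hf] : forall i : 'I_(size s),
    exists f, [/\ J f, f != 0 & mlead f = nth 0%MM s i].
  by move=> i; apply: sP; rewrite mem_nth.
exists (size s), f; split=> [i|p]; first by case: (hf i).
elim/(well_founded_ind (@ltom_wf n)): {p}(mlead p) {-2}p (erefl (mlead p)) => m IH p pm Jp.
have [->|p0] := eqVneq p 0.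
  by exists (fun=> 0); rewrite big1 // => i _; rewrite mul0r.
have [m' ms le] : exists2 m', m' \in s & (m' <= m)%MM by apply: sdom; exists p.
have i_lt : (index m' s < size s)%N by rewrite index_mem.
pose i := Ordinal i_lt; have [Jf f0 fm] := hf i.
rewrite nth_index // in fm.
(* Subtracting [t * f i] cancels the leading term of [p]. *)
pose c := p@_m / (f i)@_m'; pose t : S := c *: 'X_[m - m'].
have lt_tf : (mlead (t * f i) <= m)%O.
  apply: le_trans (mleadM_le _ _) _; rewrite -[X in (_ <= X)%O](submK le) fm lemc_add2l.
  by apply: le_trans (mleadZ_le _ _) _; rewrite mleadXm.
have e0 : (p - t * f i)@_m = 0.
  have coefX : ('X_[m - m'] * f i)@_m = (f i)@_m'.
    by rewrite -commr_mpolyX -{1}(submK le) mcoeffMX.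
  by rewrite mcoeffB /t -scalerAl mcoeffZ coefX /c divfK ?subrr // -fm mleadc_eq0.
have lem : (mlead (p - t * f i) <= m)%O.
  by apply: le_trans (mleadB_le _ _) _; rewrite leUx pm lexx lt_tf.
have Jq : J (p - t * f i) by rewrite addrC -mulNr; apply: JS.
have [a ha] : exists a, p - t * f i = \sum_i a i * f i.
  have [->|q0] := eqVneq (p - t * f i) 0.
    by exists (fun=> 0); rewrite big1 // => j _; rewrite mul0r.
  apply: IH (erefl _) Jq; rewrite lt_neqAle lem andbT; apply/negP=> /eqP E.
  by move: q0; rewrite -mleadc_eq0 E e0 eqxx.
exists (fun j => a j + (if j == i then t else 0)).
rewrite (eq_bigr _ (fun j _ => mulrDl _ _ _)) big_split /= -ha.
rewrite (bigD1 i) //= eqxx big1 ?addr0 ?subrK // => j /negbTE->.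
by rewrite mul0r.
Qed.

(** Filter the submodule by the position of the last nonzero coordinate: the
    [k]-th coordinates of its vectors supported on the first [k + 1] positions form
    an ideal, and subtracting lifts of its generators moves down the filtration. *)
Theorem submod_fgen q (Z : 'rV[S]_q -> Prop) : submodP Z ->
  exists r (D : 'M[S]_(r, q)), forall v, Z v <-> exists w, v = w *m D.
Proof.
move=> sZ; have [Z0 ZS] := sZ.
suff H k : exists r (D : 'M[S]_(r, q)), (forall i, Z (row i D)) /\
    forall v, Z v -> (forall b : 'I_q, (k <= b)%N -> v 0 b = 0) -> exists w, v = w *m D.
  have [r [D [ZD hD]]] := H q.
  exists r, D => v; split=> [Zv|[w ->]]; last exact: submod_rowim.
  by apply: hD => // b; rewrite leqNgt ltn_ord.
elim: k => [|k [r [D [ZD hD]]]].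
  exists 0%N, 0; split=> [[]//|v _ v0]; exists 0.
  by rewrite mulmx0; apply/rowP=> b; rewrite v0 // mxE.
case: (ltnP k q) => kq; last first.
  exists r, D; split=> // v Zv v0; apply: hD => // b; rewrite leqNgt.
  by rewrite (leq_trans (ltn_ord b) kq).
pose o := Ordinal kq.
pose Zk v := Z v /\ forall b : 'I_q, (k.+1 <= b)%N -> v 0 b = 0.
have [||s [f [hf fgen]]] := @ideal_fgen (fun p => exists2 v, Zk v & v 0 o = p).
- by exists 0; [split=> // b _; rewrite mxE | rewrite mxE].
- move=> a _ _ [u [Zu u0] <-] [v [Zv v0] <-]; exists (a *: u + v); last by rewrite !mxE.
  by split=> [|b kb]; [exact: ZS | rewrite !mxE u0 ?v0 ?mulr0 ?addr0].
have /fin_all_exists2[z zZ zf] := hf.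
exists (r + s)%N, (col_mx D (\matrix_i z i)); split=> [i|v Zv v0].
  case: (splitP i) => j ij.
    rewrite (_ : i = lshift s j) ?rowKu //; exact: val_inj.
  rewrite (_ : i = rshift r j) ?rowKd ?rowK; last exact: val_inj.
  by case: (zZ j).
have [a ha] := fgen (v 0 o) (ex_intro2 _ _ v (conj Zv v0) erefl).
pose u := (\row_j a j) *m (\matrix_i z i).
have Zu : Z u by apply: submod_rowim => // i; rewrite rowK; case: (zZ i).
have [||w hw] := hD (v - u).
- by rewrite addrC -scaleN1r; apply: ZS.
- move=> b; rewrite leq_eqVlt !mxE => /orP[/eqP ob|kb].
    have -> : b = o by exact/val_inj.
    rewrite ha; apply/eqP; rewrite subr_eq0; apply/eqP/eq_bigr=> i _.
    by rewrite !mxE zf.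
  rewrite v0 // big1 ?subr0 // => i _; rewrite !mxE; case: (zZ i) => _ -> //.
  by rewrite mulr0.
exists (row_mx w (\row_j a j)); rewrite mul_row_col -/u -hw subrK //.
Qed.

End Noetherian.

(** * Existence of minimal graded free resolutions *)

Lemma ex_least (P : nat -> Prop) : (exists k, P k) ->
  exists2 k, P k & forall j, P j -> (k <= j)%N.
Proof.
move=> [k Pk]; apply: NNPP => no.
have H m : forall j, (j < m)%N -> ~ P j.
  elim: m => [|m IH] j //; rewrite ltnS => jm Pj; apply: no; exists j => // i Pi.
  by rewrite leqNgt; apply/negP => ij; apply: (IH i) => //; exact: leq_trans ij jm.
exact: (H k.+1 k).
Qed.

Section MinRes.
Variables (K : fieldType) (n : nat).
Local Notation S := {mpoly K[n]}.

Definition gradedP q (t : 'I_q -> nat) (Z : 'rV[S]_q -> Prop) :=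
  forall v e, Z v -> Z (hpart t e v).

Definition presents q (t : 'I_q -> nat) (Z : 'rV[S]_q -> Prop)
    r (s : 'I_r -> nat) (D : 'M[S]_(r, q)) :=
  hommx s t D /\ forall v, Z v <-> exists w, v = w *m D.

Lemma homog_gens q (t : 'I_q -> nat) (Z : 'rV[S]_q -> Prop) :
  submodP Z -> gradedP t Z -> exists r (s : 'I_r -> nat) D, presents t Z s D.
Proof.
move=> sZ gZ; have [r [D hD]] := submod_fgen sZ.
have ZD i : Z (row i D) by apply/hD; exists (delta_mx 0 i); rewrite rowE.
have /fin_all_exists[N hN] := fun i : 'I_r => hpart_sum t (row i D).
pose M := \max_i N i; pose T : finType := ('I_r * 'I_M)%type.
pose E (x : T) : 'rV[S]_q := hpart t x.2 (row x.1 D).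
pose ev (j : 'I_#|T|) : T := enum_val j.
exists #|T|, (fun j => (ev j).2 : nat), (\matrix_j E (ev j)).
split=> [a b|v]; first by rewrite mxE; exact: hommx_hpart.
split=> [/hD[w ->]|[w ->]]; last first.
  by apply: submod_rowim => // i; rewrite rowK; exact: gZ.
exists (\row_j w 0 (ev j).1); rewrite !mulmx_sum_row.
under [RHS]eq_bigr => j _ do rewrite rowK mxE.
rewrite -(reindex ev (P := predT) (F := fun x => w 0 x.1 *: E x)) /=; last first.
  by apply: onW_bij; exact: enum_val_bij.
rewrite -(pair_bigA _ (fun i j => w 0 i *: E (i, j))) /=.
apply: eq_bigr => i _; rewrite -scaler_sumr; congr (_ *: _).
by apply: hN; exact: leq_bigmax.
Qed.

(** Take homogeneous generators in least possible number.  If a relation between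
    them had a coefficient with nonzero constant term, then the homogeneous part of
    the relation in the degree of that generator would have a nonzero scalar as
    coefficient, and the generator would be redundant. *)
Lemma minimal_gens q (t : 'I_q -> nat) (Z : 'rV[S]_q -> Prop) :
  submodP Z -> gradedP t Z ->
  exists r (s : 'I_r -> nat) D, presents t Z s D /\
    forall w : 'rV_r, w *m D = 0 -> cst0 w.
Proof.
move=> sZ gZ; have := homog_gens sZ gZ => /ex_least[r [s [D hD]] rmin].
exists r, s, D; split=> // w wD i b; rewrite {i}ord1; apply/eqP/negP => /negP c0.
case: r s D hD w wD b c0 rmin => [|r] s D [gD hD] w wD b c0 rmin; first by case: b c0.
suff /rmin : exists (s' : 'I_r -> nat) D', presents t Z s' D' by rewrite ltnn.
exists (fun j => s (lift b j)), (row' b D); split=> [i j|v].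
  by rewrite mxE; exact: gD.
pose c := (w 0 b)@_0%MM.
have [u uD uc] : exists2 u : 'rV[S]_r.+1, u *m D = 0 & u 0 b = c%:MP.
  exists (hpart s (s b) w); first by rewrite -(hpart_mul _ _ gD) wD hpart0.
  apply/mpolyP=> m; rewrite mxE mcoeff_mpart mcoeffC -{2}[s b]add0n eqn_add2r.
  rewrite mdeg_eq0; case: eqP => [->|_]; first by rewrite mulr1.
  by rewrite mulr0.
split=> [/hD[x ->]|[x ->]]; last first.
  apply: submod_rowim => // i; apply/hD; exists (delta_mx 0 (lift b i)).
  by rewrite -rowE; apply/rowP=> j; rewrite !mxE.
(* Subtracting this multiple of the relation clears the coefficient of the redundant
   generator. *)
exists (col' b (x - (x 0 b * (c^-1)%:MP) *: u)).
transitivity ((x - (x 0 b * (c^-1)%:MP) *: u) *m D).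
  by rewrite mulmxBl -scalemxAl uD scaler0 subr0.
apply/rowP=> j; rewrite !mxE (bigD1_ord b) //= !mxE uc -mulrA -mpolyCM.
rewrite mulVf // mpolyC1 mulr1 subrr mul0r add0r.
by apply: eq_bigr => i _; rewrite !mxE.
Qed.

Lemma submod_ker q r (D : 'M[S]_(r, q)) : submodP (fun v : 'rV_r => v *m D = 0).
Proof.
split=> [|a u v hu hv]; first by rewrite mul0mx.
by rewrite mulmxDl -scalemxAl hu hv scaler0 addr0.
Qed.

Lemma graded_ker q r (t : 'I_q -> nat) (s : 'I_r -> nat) (D : 'M[S]_(r, q)) :
  hommx s t D -> gradedP s (fun v : 'rV_r => v *m D = 0).
Proof. by move=> gD v e hv; rewrite -(hpart_mul _ _ gD) hv hpart0. Qed.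

(** One stage of a resolution under construction.  The condition [gm_ker] on
    the kernel is the minimality of the next differential. *)
Record gmap := GMap { gm_q : nat; gm_t : 'I_gm_q -> nat;
  gm_r : nat; gm_s : 'I_gm_r -> nat; gm_D : 'M[S]_(gm_r, gm_q);
  gm_hom : hommx gm_s gm_t gm_D;
  gm_ker : forall w : 'rV_gm_r, w *m gm_D = 0 -> cst0 w }.

Theorem minimal_resolution_exists (J : S -> Prop) :
  J 0 -> (forall a p q, J p -> J q -> J (a * p + q)) ->
  (forall p e, J p -> J (mpart (fun m => mdeg m == e) p)) ->
  exists F, minimal_free_resolution J F.
Proof.
move=> J0 JS Jh.
have [||r0 [s0 [D0 [[gD0 hD0] kD0]]]] :=
  @minimal_gens 1 (fun=> 0%N) (fun v => J (v 0 0)).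
- by split=> [|a u v hu hv]; rewrite !mxE //; exact: JS.
- move=> v e hv; rewrite mxE (@eq_mpart _ _ _ (fun m => mdeg m == e)); first exact: Jh.
  by move=> m; rewrite addn0.
have next (g : gmap) : exists h : {r : nat & {s : 'I_r -> nat & 'M[S]_(r, gm_r g)}},
    [/\ hommx (projT1 (projT2 h)) (@gm_s g) (projT2 (projT2 h)),
      forall v : 'rV_(gm_r g), v *m gm_D g = 0 <->
        exists w : 'rV_(projT1 h), v = w *m projT2 (projT2 h)
    & forall w : 'rV_(projT1 h), w *m projT2 (projT2 h) = 0 -> cst0 w].
  have [r [s [D [[gD hD] kD]]]] :=
    minimal_gens (submod_ker (gm_D g)) (graded_ker (@gm_hom g)).
  by exists (existT _ r (existT _ s D)).
pose nx g := constructive_indefinite_description _ (next g).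
have hom_nx g : hommx (projT1 (projT2 (sval (nx g)))) (@gm_s g) (projT2 (projT2 (sval (nx g)))).
  by case: (svalP (nx g)).
have ker_nx g (w : 'rV_(projT1 (sval (nx g)))) : w *m projT2 (projT2 (sval (nx g))) = 0 -> cst0 w.
  by case: (svalP (nx g)) => _ _; apply.
(* Iterating makes the target of each stage convertible to the source of the previous
   one, so that no casts between matrix types arise. *)
pose st i := iter i (fun g => GMap (hom_nx g) (@ker_nx g)) (GMap gD0 kD0).
have exact_st i (v : 'rV_(gm_r (st i))) :
    v *m gm_D (st i) = 0 <-> exists w : 'rV_(gm_r (st i.+1)),
      v = w *m (gm_D (st i.+1) : 'M_(_, gm_r (st i))).
  by case: (svalP (nx (st i))) => _ h _; exact: h.
exists (@FreeComplex K n (fun i => gm_r (st i)) (fun i => @gm_s (st i)) D0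
  (fun i => gm_D (st i.+1))); split.
- split=> [a m /gD0/eqP|i a b m /(@gm_hom (st i.+1))/eqP]; last by apply.
  by rewrite addn0.
- split; [move=> p | exact: (exact_st 0%N) | move=> i; exact: (exact_st i.+1)].
  split=> [Jp|[v <-]]; last by apply/hD0; exists v.
  have /hD0[v hv] : J ((const_mx p : 'rV[S]_1) 0 0) by rewrite mxE.
  by exists v; rewrite -hv mxE.
move=> i a b; have /(@gm_ker (st i)) : row a (gm_D (st i.+1)) *m gm_D (st i) = 0.
  by apply/exact_st; exists (delta_mx 0 a); rewrite -rowE.
by move/(_ 0 b); rewrite mxE.
Qed.

End MinRes.

(** * Monomial ideals given by up-closed sets of exponents *)

Section Monomials.
Variable n : nat.
Implicit Types (P Q : pred 'X_{1..n}) (m : 'X_{1..n}).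

Definition upset P := forall m m', P m -> P (m + m')%MM.

(** For an up-closed [P], minimality with respect to division is detected by
    removing a single variable. *)
Definition mingen P m := P m && [forall i, (0 < m i)%N ==> ~~ P (m - U_(i))%MM].

Lemma mingenP P m : reflect (P m /\ forall i, (0 < m i)%N -> ~~ P (m - U_(i))%MM) (mingen P m).
Proof.
apply: (iffP andP) => -[Pm h]; split=> //; first by move=> i; move/forallP/(_ i)/implyP: h.
by apply/forallP=> i; apply/implyP; exact: h.
Qed.

Lemma eq_mingen P Q : P =1 Q -> mingen P =1 mingen Q.
Proof. by move=> e m; rewrite /mingen e; congr andb; apply: eq_forallb => i; rewrite e. Qed.

Lemma subU_add m (i : 'I_n) : (0 < m i)%N -> (m - U_(i) + U_(i))%MM = m.
Proof. by move=> h; rewrite submK // lep1mP -lt0n. Qed.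

Lemma mingen_dvd P m : P m -> exists2 m', mingen P m' & (m' <= m)%MM.
Proof.
elim: {m}(mdeg m) {-2}m (leqnn (mdeg m)) => [|d IH] m md Pm.
  exists m; last exact: lepm_refl.
  apply/mingenP; split=> // i; move: md; rewrite leqn0 mdeg_eq0 => /eqP->.
  by rewrite mnm0E.
case: (boolP (mingen P m)) => [h|]; first by exists m => //; exact: lepm_refl.
rewrite /mingen Pm /= negb_forall => /existsP[i]; rewrite negb_imply negbK => /andP[mi Pi].
have [|m' gm' le] := IH _ _ Pi.
  by move: md; rewrite -{1}(subU_add mi) mdegD mdeg1 addn1.
by exists m' => //; apply: lepm_trans le _; exact: lem_subr.
Qed.

Definition mzero (v : 'I_n) m : 'X_{1..n} := [multinom (if i == v then 0 else m i)%N | i < n].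

Lemma mzero_id v m : m v = 0%N -> mzero v m = m.
Proof. by move=> h; apply/mnmP=> i; rewrite mnmE; case: eqP => // ->. Qed.

Lemma mzeroD v m : mzero v (m + U_(v))%MM = mzero v m.
Proof.
apply/mnmP=> i; rewrite !mnmE; case: eqP => // /eqP ne.
by rewrite eq_sym (negbTE ne) addn0.
Qed.

(** The exponents of the colon ideal by [x_v]. *)
Definition colon_var v P : pred 'X_{1..n} := fun m => P (m + U_(v))%MM.
(** The exponents of the ideal generated by the monomials of [P] free of
    [x_v]. *)
Definition elim_var v P : pred 'X_{1..n} := fun m => P (mzero v m).

Lemma mingen_elim v P m : mingen (elim_var v P) m -> mingen P m.
Proof.
move=> /mingenP[Pm h]; have mv : m v = 0%N.
  apply/eqP; rewrite -leqn0 leqNgt; apply/negP=> mv; have := h _ mv.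
  by rewrite /elim_var -mzeroD subU_add // (_ : P _).
apply/mingenP; split=> [|i mi]; first by move: Pm; rewrite /elim_var mzero_id.
by have := h _ mi; rewrite /elim_var mzero_id // mnmBE mv.
Qed.

Lemma mingen_colon_var v P m : mingen (colon_var v P) m -> ~~ P m -> mingen P (m + U_(v))%MM.
Proof.
move=> /mingenP[Pm h] nP; apply/mingenP; split=> // i.
have [->|ne] := eqVneq i v; first by rewrite addmK.
rewrite mnmDE mnm1E eq_sym (negbTE ne) addn0 => mi; have := h _ mi.
by rewrite /colon_var addmC addmBA 1?addmC // lep1mP -lt0n.
Qed.

(** The exponents of the product with the monomial of exponent [t]. *)
Definition translate t P : pred 'X_{1..n} := fun m => (t <= m)%MM && P (m - t)%MM.

Lemma mingen_translate t P m : mingen P m -> mingen (translate t P) (m + t)%MM.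
Proof.
move=> /mingenP[Pm h]; apply/mingenP; split; first by rewrite /translate lem_addl addmK.
move=> i hi; rewrite /translate; case: mnm_lepP => //= le.
have mi : (0 < m i)%N.
  by move: (le i) hi; rewrite mnmBE !mnmDE mnm1E eqxx /=; lia.
have := h _ mi; rewrite (_ : (m - U_(i) = m + t - U_(i) - t)%MM) //.
by apply/mnmP=> j; rewrite !mnmE; lia.
Qed.

End Monomials.

Section Divide.
Variables (K : fieldType) (n : nat).
Implicit Types p f : {mpoly K[n]}.

Lemma supportedXM (A B : pred 'X_{1..n}) t f : 
  supported A ('X_[t] * f) -> (forall m, A (t + m)%MM -> B m) -> supported B f.
Proof.
move=> h AB m; rewrite mcoeff_msupp => fm; apply/AB/h.
by rewrite mcoeff_msupp -commr_mpolyX mcoeffMX.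
Qed.

Lemma mpoly_divX t p : supported (fun m => (t <= m)%MM) p -> exists f, p = 'X_[t] * f.
Proof.
move=> h; exists (\sum_(m <- msupp p) p@_m *: 'X_[m - t]).
rewrite mulr_sumr {1}[p]mpolyE; apply: eq_big_seq => m /h le.
by rewrite -scalerAr -mpolyXD addmC submK.
Qed.

End Divide.

(** * Graded free resolutions bounded by generator degrees *)

Lemma dependent_choice (T : nat -> Type) (R : forall i, T i -> T i.+1 -> Prop) (x : T 0%N) :
  (forall i y, exists z, @R i y z) ->
  exists f : forall i, T i, f 0%N = x /\ forall i, R i (f i) (f i.+1).
Proof.
move=> tot; pose nx i y := constructive_indefinite_description _ (tot i y).
exists (nat_rect T x (fun i y => sval (nx i y))); split=> // i.
exact: (svalP (nx i _)).
Qed.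

Section Cone.
Variables (K : fieldType) (n : nat).
Local Notation S := {mpoly K[n]}.
Implicit Types P Q : pred 'X_{1..n}.

(** The shifts are compared with degrees of minimal generators and not with a fixed
    number: in this form the bound passes through colons, eliminations and
    translations by transporting the generator. *)
Definition bounded_res (P : pred 'X_{1..n}) := exists F : free_complex K n,
  [/\ fr_graded F, fr_exact (supported P) F
    & forall i (a : 'I_(fr_rank F i)), exists2 m, mingen P m & (fr_shift a <= mdeg m + i)%N].

Lemma fr_exact_ext (I J : S -> Prop) F : (forall p, I p <-> J p) -> fr_exact I F -> fr_exact J F.
Proof. by move=> e [h0 h1 h2]; split=> // p; rewrite -e. Qed.

Lemma eq_bounded_res P Q : P =1 Q -> bounded_res P -> bounded_res Q.
Proof.
move=> e [F [gF xF bF]]; exists F; split=> //.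
  by apply: fr_exact_ext xF => p; split; apply: sub_supported => m; rewrite /= e.
by move=> i a; have [m hm le] := bF i a; exists m; rewrite // -(eq_mingen e).
Qed.

Lemma bounded_res_unit : bounded_res predT.
Proof.
pose r i := if i is 0 then 1%N else 0%N.
exists (@FreeComplex K n r (fun _ _ => 0%N) (const_mx 1) (fun i => 0)); split.
- split=> [a m|i []//]; rewrite mxE -mpolyC1 msupp1 inE => /eqP->.
  exact: mdeg0.
- split=> /= [p|v|i v].
  + split=> // _; exists (const_mx p); rewrite mxE big_ord1 !mxE mulr1 //.
  + split=> [h|[w ->]]; last by rewrite mulmx0 mul0mx.
    exists 0; rewrite mul0mx; apply/rowP=> j; move/rowP/(_ 0): h.
    by rewrite !mxE big_ord1 !mxE mulr1 [j]ord1.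
  by split=> _; last (by rewrite mulmx0); exists 0; apply/rowP=> j; have := ltn_ord j; rewrite ltn0.
- case=> [|i] [] // a la; exists 0%MM => //.
  by apply/mingenP; split=> // j; rewrite mnm0E.
Qed.

Lemma bounded_res_translate t P : bounded_res P -> bounded_res (translate t P).
Proof.
move=> [F [[gF0 gF] [xF0 xF1 xF2] bF]].
exists (@FreeComplex K n (fr_rank F) (fun i a => @fr_shift _ _ F i a + mdeg t)%N
   ('X_[t] *: fr_aug F) (fr_diff F)); split.
- split=> [a m|i a b m /gF E] /=; last by rewrite addnA E.
  rewrite mxE mulrC => /msuppM_le/allpairsP[[m1 m2] /= [/gF0 E /mem_msuppXP <- ->]].
  by rewrite mdegD E.
- split=> //= [p|v].
    split=> [h|[v <-]]; last first.
      have : supported P ((v *m fr_aug F) 0 0) by apply/xF0; exists v.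
      move=> h; rewrite -scalemxAr mxE; apply: (supportedM (A := pred1 t) _ h).
        by apply/supportedX => /=.
      by move=> m1 m2 /eqP-> Pm; rewrite /translate lem_addr addmC addmK.
    have [f ef] : exists f, p = 'X_[t] * f by apply: mpoly_divX => m /h/andP[].
    have /xF0[v hv] : supported P f.
      rewrite ef in h; apply: supportedXM h _ => m /andP[_].
      by rewrite addmC addmK.
    by exists v; rewrite -scalemxAr mxE hv.
  rewrite -xF1 -scalemxAr; split=> [/eqP|->]; last by rewrite scaler0.
  move=> /eqP /rowP h; apply/rowP=> j; move: (h j); rewrite !mxE ord1 => /eqP.
  rewrite mulf_eq0 => /orP[/eqP X0|/eqP//].
  by have := mcoeffX K t t; rewrite X0 mcoeff0 eqxx => /eqP; rewrite eq_sym oner_eq0.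
- move=> i a /=; have [m hm le] := bF i a; exists (m + t)%MM; first exact: mingen_translate.
  by rewrite mdegD addnAC leq_add2r.
Qed.

Lemma chain_map (I J : S -> Prop) (F G : free_complex K n) :
  (forall p, I p -> J p) -> fr_graded F -> fr_exact I F -> fr_graded G -> fr_exact J G ->
  exists phi : forall i, 'M[S]_(fr_rank F i, fr_rank G i),
  [/\ forall i, hommx (@fr_shift _ _ F i) (@fr_shift _ _ G i) (phi i),
      fr_aug F = phi 0%N *m fr_aug G
    & forall i, fr_diff F i *m phi i = phi i.+1 *m fr_diff G i].
Proof.
move=> IJ gF xF gG xG.
have [xF0 xF1 xF2] := xF; have [xG0 xG1 xG2] := xG.
have hF0 := hommx_aug gF; have hG0 := hommx_aug gG.
have hF := hommx_diff gF; have hG := hommx_diff gG.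
have aug0 (v : 'rV_(fr_rank F 0)) : exists w : 'rV_(fr_rank G 0), v *m fr_aug F = w *m fr_aug G.
  have /IJ/xG0[w hw] : I ((v *m fr_aug F) 0 0) by apply/xF0; exists v.
  by exists w; apply/rowP=> j; rewrite ord1.
have [phi0 hphi0 ephi0] := homog_lift hF0 hG0 aug0.
pose T i := {phi : 'M[S]_(fr_rank F i, fr_rank G i) |
   hommx (@fr_shift _ _ F i) (@fr_shift _ _ G i) phi /\
   exists X, fr_diff F i *m phi = X *m fr_diff G i}.
have h0 : exists X, fr_diff F 0 *m phi0 = X *m fr_diff G 0.
  by apply: mx_lift => v; apply/xG1; rewrite -!mulmxA -ephi0 (diff_aug xF) mulmx0.
have step i (x : T i) : exists y : T i.+1, fr_diff F i *m sval x = sval y *m fr_diff G i.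
  case: x => phi [hphi [X hX]] /=.
  have [v|phi' hphi' e] := homog_lift (hommx_mul (hF i) hphi) (hG i).
    by exists (v *m X); rewrite hX mulmxA.
  have h' : exists X, fr_diff F i.+1 *m phi' = X *m fr_diff G i.+1.
    apply: mx_lift => v; apply/xG2; rewrite -!mulmxA -e [X in v *m X]mulmxA.
    by rewrite (diff_diff xF) mul0mx mulmx0.
  by exists (exist _ phi' (conj hphi' h')).
have [f [f0 fS]] := dependent_choice (exist _ phi0 (conj hphi0 h0) : T 0%N) step.
exists (fun i => sval (f i)); split=> // [i|]; first by case: (svalP (f i)).
by rewrite f0.
Qed.

Definition shcat p q (s : 'I_p -> nat) (t : 'I_q -> nat) (a : 'I_(p + q)) :=
  match split a with inl b => s b | inr c => t c end.

Lemma hommx_row p q r (s : 'I_p -> nat) (t : 'I_q -> nat) (u : 'I_r -> nat) (A : 'M[S]_(p, q)) B :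
  hommx s t A -> hommx s u B -> hommx s (shcat t u) (row_mx A B).
Proof. by move=> hA hB a b; rewrite mxE /shcat; case: split. Qed.

Lemma hommx_col p q r (s : 'I_p -> nat) (t : 'I_q -> nat) (u : 'I_r -> nat) (A : 'M[S]_(p, r)) B :
  hommx s u A -> hommx t u B -> hommx (shcat s t) u (col_mx A B).
Proof. by move=> hA hB a b; rewrite mxE /shcat; case: split. Qed.

Lemma hommx0 p q (s : 'I_p -> nat) (t : 'I_q -> nat) : hommx s t (0 : 'M[S]__).
Proof. by move=> a b; rewrite mxE; exact: supported0. Qed.

Lemma hommxN p q (s : 'I_p -> nat) (t : 'I_q -> nat) (A : 'M[S]_(p, q)) :
  hommx s t A -> hommx s t (- A).
Proof. by move=> h a b; rewrite mxE; exact: supportedN. Qed.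

Lemma hommx_succ p q (s : 'I_p -> nat) (t : 'I_q -> nat) (A : 'M[S]_(p, q)) :
  hommx s t A -> hommx (fun a => (s a).+1) (fun a => (t a).+1) A.
Proof. by move=> h a b m /h /eqP <-; rewrite addnS. Qed.

Section Construction.
Variables (v : 'I_n) (F2 F1 : free_complex K n).
Variable phi : forall i, 'M[S]_(fr_rank F1 i, fr_rank F2 i).

(** [F1] moved up by one homological degree, with the zero module in degree 0. *)
Definition prev_rank i := if i is j.+1 then fr_rank F1 j else 0%N.
Definition prev_shift i : 'I_(prev_rank i) -> nat :=
  if i is j.+1 then fun a => (@fr_shift _ _ F1 j a).+1 else fun _ => 0%N.
Definition prev_diff i : 'M[S]_(fr_rank F1 i, prev_rank i) :=
  if i is j.+1 then fr_diff F1 j else 0.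

(** The mapping cone of the chain map [(phi, - x_v)] from [F1(-1)] to the direct
    sum of [F2(-1)] and [F1]; it resolves [x_v I2 + I1] when [F2] resolves [I2] and
    [F1] resolves [I1], by way of the exact sequence
    [0 -> I1(-1) -> I2(-1) + I1 -> x_v I2 + I1 -> 0]. *)
Definition cone := @FreeComplex K n
  (fun i => fr_rank F2 i + fr_rank F1 i + prev_rank i)%N
  (fun i => shcat (shcat (fun a => (@fr_shift _ _ F2 i a).+1) (@fr_shift _ _ F1 i)) (@prev_shift i))
  (col_mx (col_mx ('X_v *: fr_aug F2) (fr_aug F1)) 0)
  (fun i => block_mx (block_mx (fr_diff F2 i) 0 0 (fr_diff F1 i)) 0
                     (row_mx (phi i) (- 'X_v)%:M) (- prev_diff i)).

Lemma cone_graded : fr_graded F2 -> fr_graded F1 ->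
  (forall i, hommx (@fr_shift _ _ F1 i) (@fr_shift _ _ F2 i) (phi i)) -> fr_graded cone.
Proof.
move=> [g20 g2] [g10 g1] hphi; split=> [a m|i a b m].
  suff : hommx (@fr_shift _ _ cone 0) (fun _ : 'I_1 => 0%N) (fr_aug cone).
    by move=> h /h/eqP; rewrite addn0.
  apply: hommx_col; last exact: hommx0.
  apply: hommx_col => c d m'; last by rewrite ord1 addn0 => /g10/eqP.
  rewrite ord1 mxE => /msuppM_le/allpairsP[[m1 m2] /= [/mem_msuppXP <- /g20 <- ->]].
  by rewrite mdegD mdeg1 addn0.
suff h : hommx (@fr_shift _ _ cone i.+1) (@fr_shift _ _ cone i) (fr_diff cone i).
  by move/h/eqP.
apply: hommx_col; apply: hommx_row.
- apply: hommx_col; apply: hommx_row; try exact: hommx0.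
    by apply: hommx_succ => c d m' /g2/eqP.
  by move=> c d m' /g1/eqP.
- exact: hommx0.
- apply: hommx_row; first by apply: hommx_succ; exact: hphi.
  move=> c d m'; rewrite mxE; case: eqP => [->|_]; last by move/supported0=> /(_ xpred0).
  by rewrite mulr1n (perm_mem (msuppN _)) => /mem_msuppXP <-; rewrite mdeg1 add1n.
apply: hommxN; case: i {a b} => [|i]; first exact: hommx0.
by apply: hommx_succ => c d m' /g1/eqP.
Qed.

Lemma cone_mul i u u' z : row_mx (row_mx u u') z *m fr_diff cone i =
  row_mx (row_mx (u *m fr_diff F2 i + z *m phi i) (u' *m fr_diff F1 i - 'X_v *: z))
    (- (z *m prev_diff i)) :> 'rV[S]_(_ + _ + _).
Proof.
rewrite /= !mul_row_block !mulmx0 !add0r addr0 mulmxN.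
by rewrite mul_mx_row add_row_mx mul_mx_scalar scaleNr.
Qed.

Lemma cone_aug u u' z : row_mx (row_mx u u') z *m fr_aug cone =
  'X_v *: (u *m fr_aug F2) + u' *m fr_aug F1 :> 'rV[S]_1.
Proof. by rewrite /= !mul_row_col mulmx0 addr0 -scalemxAr. Qed.

Lemma cone_split i (w : 'rV[S]_(fr_rank cone i)) :
  exists u u' z, w = row_mx (row_mx u u') z :> 'rV[S]_(_ + _ + _).
Proof.
exists (lsubmx (lsubmx w)), (rsubmx (lsubmx w)), (rsubmx w).
by rewrite !hsubmxK.
Qed.

End Construction.
End Cone.

Section Splitting.
Variables (K : fieldType) (n : nat).
Local Notation S := {mpoly K[n]}.
Implicit Types P Q : pred 'X_{1..n}.

(** Every cycle of the cone has a component in [F1(-1)] that is a boundary; once it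
    is subtracted, exactness of [F2] and [F1] finishes.  In degree 0 the point is
    that an [f] with [x_v f] in [I1] lies in [I1], the latter being generated by
    monomials free of [x_v]. *)
Lemma cone_exact v P (F2 F1 : free_complex K n)
    (phi : forall i, 'M[S]_(fr_rank F1 i, fr_rank F2 i)) : upset P ->
  fr_exact (supported (colon_var v P)) F2 -> fr_exact (supported (elim_var v P)) F1 ->
  fr_aug F1 = phi 0%N *m fr_aug F2 ->
  (forall i, fr_diff F1 i *m phi i = phi i.+1 *m fr_diff F2 i) ->
  fr_exact (supported P) (cone v phi).
Proof.
move=> upP [x20 x21 x22] [x10 x11 x12] ephi0 ephi.
split.
- move=> p; split=> [Pp|[w <-]].
    pose A : pred 'X_{1..n} := fun m => (0 < m v)%N.
    have [f ef] : exists f, mpart A p = 'X_[U_(v)] * f.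
      apply: mpoly_divX; apply: sub_supported (@supported_mpart _ _ A p) => m /=.
      by rewrite lep1mP -lt0n.
    have pP B : supported P (mpart B p).
      move=> m; rewrite mcoeff_msupp mcoeff_mpart.
      by case: ifP; rewrite ?eqxx // -mcoeff_msupp => _ /Pp.
    have /x20[u hu] : supported (colon_var v P) f.
      have := pP A; rewrite ef => /supportedXM; apply=> m.
      by rewrite addmC.
    have /x10[u' hu'] : supported (elim_var v P) (mpart (predC A) p).
      move=> m hm; rewrite /elim_var mzero_id; first exact: pP hm.
      by have := supported_mpart hm; rewrite /= /A lt0n negbK => /eqP.
    exists (row_mx (row_mx u u') 0); rewrite cone_aug mxE [X in X + _]mxE hu hu' -ef.
    by rewrite -mpart_split.
  have [u [u' [z ->]]] := cone_split w; rewrite cone_aug mxE [X in X + _]mxE.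
  have h2 : supported (colon_var v P) ((u *m fr_aug F2) 0 0) by apply/x20; exists u.
  have h1 : supported (elim_var v P) ((u' *m fr_aug F1) 0 0) by apply/x10; exists u'.
  apply: supportedD.
    apply: (supportedM (A := pred1 U_(v)%MM) _ h2); first by apply/supportedX; exact: eqxx.
    by move=> m1 m2 /eqP-> ; rewrite /colon_var addmC.
  apply: sub_supported h1 => m; rewrite /elim_var => Pm.
  have -> : m = (mzero v m + U_(v) *+ m v)%MM.
    apply/mnmP=> i; rewrite mnmDE mulmnE mnm1E mnmE eq_sym.
    by case: eqP => [->|_]; rewrite ?mul1n // mul0n addn0.
  exact: upP.
- move=> w; have [u [u' [z ->]]] := cone_split w.
  split=> [|[t]].
    rewrite cone_aug => h.
    have hz : z = 0 by apply/rowP=> j; have := ltn_ord j; rewrite ltn0.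
    have /x10[t ht] : supported (elim_var v P) ((u *m fr_aug F2) 0 0).
      have h1 : supported (elim_var v P) ((u' *m fr_aug F1) 0 0) by apply/x10; exists u'.
      apply: (supportedXM (t := U_(v)) (A := elim_var v P)); last first.
        by move=> m; rewrite /elim_var addmC mzeroD.
      move/rowP/(_ 0): h; rewrite mxE [X in X + _]mxE [RHS]mxE => /eqP.
      by rewrite addr_eq0 => /eqP->; exact: supportedN.
    have et : u *m fr_aug F2 = t *m fr_aug F1 by apply/rowP=> j; rewrite ord1 ht.
    have /x21[t2 h2] : (u - t *m phi 0%N) *m fr_aug F2 = 0.
      by rewrite mulmxBl -mulmxA -ephi0 et subrr.
    have /x11[t1 h1] : (u' + 'X_v *: t) *m fr_aug F1 = 0.
      by rewrite mulmxDl -scalemxAl -et addrC.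
    exists (row_mx (row_mx t2 t1) t); rewrite cone_mul -h2 -h1 subrK addrK.
    by rewrite hz mulmx0 oppr0.
  have [t2 [t1 [s ->]]] := cone_split t; rewrite cone_mul.
  move=> /eq_row_mx[/eq_row_mx[-> ->] _]; rewrite cone_aug.
  rewrite mulmxDl mulmxBl (_ : t2 *m _ *m _ = 0); last by apply/x21; exists t2.
  rewrite (_ : t1 *m _ *m _ = 0); last by apply/x11; exists t1.
  by rewrite -mulmxA -ephi0 add0r sub0r -scalemxAl subrr.
move=> i w; have [u [u' [z ->]]] := cone_split w.
have d1 (t : 'rV_(fr_rank F1 i.+1)) : t *m fr_diff F1 i *m prev_diff F1 i = 0.
  case: i t {w u u' z} => [|i] t /=; first by rewrite mulmx0.
  by apply/x12; exists t.
split=> [|[t]].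
  rewrite cone_mul => /eqP; rewrite !row_mx_eq0 oppr_eq0 => /andP[/andP[/eqP h2 /eqP h1] /eqP hz].
  have [t ht] : exists t, z = t *m fr_diff F1 i.
    case: i w u u' z h2 h1 hz {d1} => [|i] w u u' z h2 h1 hz; last exact/x12.
    apply/x11; rewrite ephi0 mulmxA; move/eqP: h2; rewrite addrC addr_eq0 => /eqP->.
    by rewrite mulNmx (_ : u *m _ *m _ = 0) ?oppr0 //; apply/x21; exists u.
  have /x22[t2 h2'] : (u + t *m phi i.+1) *m fr_diff F2 i = 0.
    by rewrite mulmxDl -mulmxA -ephi mulmxA -ht.
  have /x12[t1 h1'] : (u' - 'X_v *: t) *m fr_diff F1 i = 0.
    by rewrite mulmxBl -scalemxAl -ht.
  (* The sign makes up for that of [- prev_diff] in the differential of the cone. *)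
  exists (row_mx (row_mx t2 t1) (- t)); rewrite cone_mul -h2' -h1' mulNmx addrK.
  by rewrite scalerN opprK subrK /= mulNmx opprK -ht.
have [t2 [t1 [s ->]]] := cone_split t; rewrite cone_mul.
move=> /eq_row_mx[/eq_row_mx[-> ->] ->]; rewrite cone_mul /= !mulNmx d1 !oppr0.
rewrite mulmxDl mulmxBl (_ : t2 *m _ *m _ = 0); last by apply/x22; exists t2.
rewrite (_ : t1 *m _ *m _ = 0); last by apply/x12; exists t1.
rewrite -!mulmxA -ephi add0r subrr sub0r -scalemxAl scalerN opprK addrC subrr.
by rewrite !row_mx0.
Qed.

(** The hypothesis on minimal generators makes [m + U_(v)] a minimal generator of
    [P] for each minimal generator [m] of the colon ideal; those of [elim_var v P]
    are minimal generators of [P] in any case. *)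
Lemma bounded_res_split v P : upset P -> (forall m, mingen (colon_var v P) m -> ~~ P m) ->
  bounded_res K (colon_var v P) -> bounded_res K (elim_var v P) -> bounded_res K P.
Proof.
move=> upP shed [F2 [g2 x2 b2]] [F1 [g1 x1 b1]].
have sub (p : {mpoly K[n]}) : supported (elim_var v P) p -> supported (colon_var v P) p.
  apply: sub_supported => m; rewrite /elim_var /colon_var => h.
  have -> : (m + U_(v) = mzero v m + U_(v) *+ (m v).+1)%MM.
    apply/mnmP=> i; rewrite !mnmDE mulmnE mnm1E mnmE eq_sym.
    by case: eqP => [->|_]; rewrite ?mul1n ?addn1 // mul0n !addn0.
  exact: upP.
have [phi [hphi ephi0 ephi]] := chain_map sub g1 x1 g2 x2.
exists (cone v phi); split; [exact: cone_graded | exact: cone_exact|].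
move=> i a; rewrite /= /shcat; case: splitP => [c _|c _].
  case: splitP => [b _|b _].
    have [m hm le] := b2 _ b; exists (m + U_(v))%MM; first exact/mingen_colon_var/shed.
    by rewrite mdegD mdeg1 addn1 addSn.
  by have [m /mingen_elim hm le] := b1 _ b; exists m.
case: i c {a} => [|i] c; first by have := ltn_ord c; rewrite ltn0.
by have [m /mingen_elim hm le] := b1 _ c; exists m; rewrite // addnS.
Qed.

End Splitting.

(** * Weighted covers and shedding vertices *)

Section Weights.
Variable n : nat.
Implicit Types (w : 'I_n -> 'I_n -> nat) (m : 'X_{1..n}) (u v : 'I_n).

(** The exponents of the intersection of the ideals [(x_i, x_j)^(w i j)]. *)
Definition cov w : pred 'X_{1..n} := fun m => [forall i, forall j, (w i j <= m i + m j)%N].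

Lemma covP w m : reflect (forall i j, (w i j <= m i + m j)%N) (cov w m).
Proof.
apply: (iffP forallP) => h i; first by move=> j; move/forallP: (h i).
by apply/forallP=> j; exact: h.
Qed.

Lemma upset_cov w : upset (cov w).
Proof. by move=> m m' /covP h; apply/covP=> i j; have := h i j; rewrite !mnmDE; lia. Qed.

Definition weight w := (forall i j, w i j = w j i) /\ forall i, w i i = 0%N.

Definition wcolon v w : 'I_n -> 'I_n -> nat := fun i j => (w i j - ((i == v) || (j == v)))%N.

(** A monomial free of [x_v] has exponent at least [w v j] in each [x_j]; the
    requirement of the edge [ij] is what is left of [w i j] after this. *)
Definition wdel v w : 'I_n -> 'I_n -> nat := fun i j =>
  (if (i == v) || (j == v) then 0 else w i j - w v i - w v j)%N.

Lemma cov_wcolon v w : weight w -> cov (wcolon v w) =1 colon_var v (cov w).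
Proof.
move=> [_ wii] m; apply/covP/covP=> h i j; have := h i j;
  rewrite /wcolon !mnmDE !mnm1E ![v == _]eq_sym.
  by case: (eqVneq i v) => [->|_]; case: (eqVneq j v) => [->|_] /=; rewrite ?wii; lia.
by case: (eqVneq i v) => [->|_]; case: (eqVneq j v) => [->|_] /=; rewrite ?wii; lia.
Qed.

Lemma cov_wdel v w : weight w ->
  translate [multinom w v j | j < n] (cov (wdel v w)) =1 elim_var v (cov w).
Proof.
move=> [ws wii] m; apply/idP/idP => [/andP[/mnm_lepP le /covP h]|/covP h].
  apply/covP=> i j; have := h i j; rewrite /wdel !mnmE.
  have := le i; have := le j; rewrite !mnmE.
  case: (eqVneq i v) => [->|_]; case: (eqVneq j v) => [->|_] /=; rewrite ?wii //; try lia.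
  by rewrite ws; lia.
have le j : (w v j <= m j)%N.
  have := h v j; rewrite !mnmE eqxx; case: (eqVneq j v) => [->|_]; rewrite ?wii //; lia.
apply/andP; split; first by apply/mnm_lepP=> j; rewrite mnmE.
apply/covP=> i j; have := h i j; have := le i; have := le j; rewrite /wdel !mnmE.
by case: (eqVneq i v) => [->|_]; case: (eqVneq j v) => [->|_] //=; lia.
Qed.

Definition sheds w u v := (0 < w u v)%N /\ forall j, j != v -> (w u j <= w v j)%N.

(** A minimal generator [m] of the colon ideal lying in [I] is free of [x_v], hence
    [m j >= w v j >= w u j] for all [j].  The exponent of [x_u] is then only
    constrained by the edge [uv], whose weight has just dropped by one, and it can be
    lowered. *)
Lemma sheds_mingen w u v : weight w -> sheds w u v ->
  forall m, mingen (colon_var v (cov w)) m -> ~~ cov w m.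
Proof.
move=> ww [uv dom] m mm; apply/negP=> cm; have [ws wii] := ww.
have mv : m v = 0%N.
  apply/eqP; rewrite -leqn0 leqNgt; apply/negP=> mv.
  case/mingenP: mm => _ /(_ v mv); rewrite /colon_var subU_add // cm //.
have c j : (w v j <= m j)%N by have /covP/(_ v j) := cm; rewrite mv.
have uvne : u != v by apply/eqP=> e; rewrite e wii in uv.
have mu : (0 < m u)%N by apply: leq_trans (c u); rewrite ws.
case/mingenP: mm => _ /(_ u mu) /negP; apply; rewrite -(cov_wcolon v ww).
have mU (k : 'I_n) : (m - U_(u))%MM k = (m k - (u == k))%N by rewrite mnmBE mnm1E.
have key j : j != u -> (wcolon v w u j <= m u - 1 + m j)%N.
  move=> ju; rewrite /wcolon (negbTE uvne) /=; have := c u; rewrite ws.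
  case: (eqVneq j v) => [->|jv]; first by rewrite mv; lia.
  by have := dom _ jv; have := c j; lia.
apply/covP=> i j; rewrite !mU.
case: (eqVneq u i) => [<-|ui]; case: (eqVneq u j) => [<-|uj]; rewrite ?subn0.
- by rewrite /wcolon wii.
- by apply: key; rewrite eq_sym.
- rewrite addnC /wcolon ws orbC; apply: key; by rewrite eq_sym.
by rewrite /wcolon; have /covP/(_ i j) := cm; lia.
Qed.

Lemma weight_wcolon v w : weight w -> weight (wcolon v w).
Proof. by move=> [ws wii]; split=> [i j|i]; rewrite /wcolon ?wii // ws orbC. Qed.

Lemma weight_wdel v w : weight w -> weight (wdel v w).
Proof.
move=> [ws wii]; split=> [i j|i]; rewrite /wdel; last by rewrite wii; case: ifP.
by rewrite orbC; case: ifP => // _; rewrite ws -subnDA addnC subnDA.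
Qed.

Definition wsum w := (\sum_(p : 'I_n * 'I_n) w p.1 p.2)%N.

Lemma ltn_wsum w w' i j : (forall a b, w' a b <= w a b)%N -> (w' i j < w i j)%N ->
  (wsum w' < wsum w)%N.
Proof.
move=> le lt; rewrite /wsum (bigD1 (i, j)) //= [X in (_ < X)%N](bigD1 (i, j)) //=.
by rewrite -addSn leq_add // leq_sum.
Qed.

(** Induction on the total weight, which drops in both branches since the edge
    [uv] of positive weight meets [v]. *)
Theorem bounded_res_cov (K : fieldType) (C : ('I_n -> 'I_n -> nat) -> Prop) :
  (forall w, C w -> weight w) ->
  (forall w, C w -> (forall i j, w i j = 0%N) \/
     exists u v, [/\ sheds w u v, C (wcolon v w) & C (wdel v w)]) ->
  forall w, C w -> bounded_res K (cov w).
Proof.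
move=> Cw Cs w; elim: {w}(wsum w) {-2}w (leqnn (wsum w)) => [|d IH] w wd cw.
  have [w0|[u [v [[uv _] _ _]]]] := Cs w cw.
    apply: eq_bounded_res (bounded_res_unit K n) => m; apply/esym/covP=> i j.
    by rewrite w0.
  by have := leq_trans (@ltn_wsum w (fun _ _ => 0%N) u v (fun _ _ => leq0n _) uv) wd.
have [w0|[u [v [sh Cc Cd]]]] := Cs w cw.
  apply: eq_bounded_res (bounded_res_unit K n) => m; apply/esym/covP=> i j.
  by rewrite w0.
have ww := Cw _ cw; have [uv _] := sh.
apply: (@bounded_res_split _ _ v); first exact: upset_cov.
- exact: sheds_mingen ww sh.
- apply: eq_bounded_res (cov_wcolon v ww) _; apply: IH Cc.
  rewrite -ltnS; apply: leq_trans wd; apply: (@ltn_wsum _ _ u v) => [a b|].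
    exact: leq_subr.
  by rewrite /wcolon eqxx orbT subn1 prednK.
apply: eq_bounded_res (cov_wdel v ww) _; apply: bounded_res_translate; apply: IH Cd.
rewrite -ltnS; apply: leq_trans wd; apply: (@ltn_wsum _ _ u v) => [a b|].
  by rewrite /wdel; case: ifP => // _; rewrite -subnDA leq_subr.
by rewrite /wdel eqxx orbT.
Qed.

End Weights.

(** * The structure of Cameron-Walker graphs and their weights *)

Section Shape.
Variables (n : nat) (adj : rel 'I_n) (f : 'I_n -> 'I_n) (L : pred 'I_n).

(** The involution [f] encodes a matching, its fixed points being the unmatched
    vertices, and [L] marks one end of every matched edge that has an end of degree
    one.  The other matched edges are sides of triangles whose third vertex is
    unmatched. *)
Record cw_shape : Prop := CWShape {
  shape_invol : involutive f;
  shape_mate : forall v, f v != v -> adj v (f v);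
  shape_matched : forall u v, adj u v -> f u != u -> f v != v -> v = f u;
  shape_free : forall u v, adj u v -> f u = u -> f v != v;
  shape_leaf : forall v, L v -> [/\ f v != v, ~~ L (f v) & forall u, adj v u -> u = f v];
  shape_tri : forall v, f v != v -> ~~ L v -> ~~ L (f v) ->
    exists r, [/\ f r = r, adj v r, adj (f v) r
              & forall u, adj v u -> u = f v \/ u = r]
}.

(** The last condition says that the edge from [f v] to its leaf [v] is the heaviest
    one at [f v]: when it has been exhausted by shedding [f v], the vertex [f v] has
    become isolated. *)
Definition cw_weight (w : 'I_n -> 'I_n -> nat) :=
  [/\ forall i j, w i j = w j i, forall i j, (0 < w i j)%N -> adj i j
    & forall v u, L v -> (w (f v) u <= w (f v) v)%N].

Hypotheses (adj_sym : ssrbool.symmetric adj) (adj_irr : irreflexive adj) (sh : cw_shape).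

Lemma cw_weightP w : cw_weight w -> weight w.
Proof.
move=> [ws wa _]; split=> // i; apply/eqP; rewrite -leqn0 leqNgt.
by apply/negP=> /wa; rewrite adj_irr.
Qed.

Lemma weight0 w i j : cw_weight w -> ~~ adj i j -> w i j = 0%N.
Proof.
move=> [_ wa _] h; apply/eqP; rewrite -leqn0 leqNgt; apply/negP=> /wa.
exact/negP.
Qed.

Lemma leaf_nadj v u : L v -> u != f v -> ~~ adj v u.
Proof. by move=> /(shape_leaf sh)[_ _ h]; apply: contra => /h ->. Qed.

Lemma cw_weight_wcolon w v : cw_weight w -> ~~ L v -> cw_weight (wcolon v w).
Proof.
move=> cw Lv; have [ws wa wl] := cw; have [ws' _] := weight_wcolon v (cw_weightP cw).
split=> // [i j h|y u Ly].
  by apply: wa; apply: leq_trans h (leq_subr _ _).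
have yv : y != v by apply: contraNneq Lv => <-.
rewrite /wcolon (negbTE yv) orbF; have := wl _ u Ly.
by case: (f y == v); case: (u == v) => /=; lia.
Qed.

Lemma cw_weight_wdel w v : cw_weight w -> ~~ L v -> cw_weight (wdel v w).
Proof.
move=> cw Lv; have [ws wa wl] := cw; have [ws' _] := weight_wdel v (cw_weightP cw).
split=> // [i j|y u Ly].
  by rewrite /wdel; case: ifP => // _ h; apply: wa; move: h; rewrite -subnDA subn_gt0; lia.
have yv : y != v by apply: contraNneq Lv => <-.
rewrite /wdel (negbTE yv) orbF; case: (eqVneq (f y) v) => //= fyv.
case: (u == v) => //; have := wl _ u Ly.
rewrite (_ : w v y = 0%N) ?(ws v) ?(@weight0 _ y v) //; first lia.
by apply: leaf_nadj; rewrite // eq_sym.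
Qed.

(** While the edge from a leaf [y] to [f y] has positive weight, [f y] sheds because
    [y] has no other neighbour.  Afterwards all edges at the vertices [f y] have
    weight zero.  A side [x, f x] of positive weight in a triangle with apex [r] sheds
    the end of it that has the heavier edge to [r].  When no such side remains, an edge
    of positive weight joins an unmatched vertex [i] to some [j] having no other edge
    of positive weight, and [i] sheds. *)
Lemma cw_weight_sheds w : cw_weight w -> (forall i j, w i j = 0%N) \/
  exists u v, [/\ sheds w u v, cw_weight (wcolon v w) & cw_weight (wdel v w)].
Proof.
move=> cw; have [ws wa wl] := cw; have [_ wii] := cw_weightP cw.
suff : (forall i j, w i j = 0%N) \/ exists u v, ~~ L v /\ sheds w u v.
  case=> [|[u [v [Lv s]]]]; [by left | right; exists u, v; split=> //].
    exact: cw_weight_wcolon.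
  exact: cw_weight_wdel.
case: (pickP (fun y => L y && (0 < w y (f y))%N)) => [y /andP[Ly wy]|noL].
  right; exists y, (f y); have [_ Lfy _] := shape_leaf sh Ly; split=> //; split=> // j jf.
  by rewrite (weight0 cw) //; exact: leaf_nadj.
case: (pickP (fun x => [&& f x != x, ~~ L x, ~~ L (f x) & (0 < w x (f x))%N])) => [x|noT].
  move=> /and4P[fx Lx Lfx wx]; right.
  have [r [fr xr _ nx]] := shape_tri sh fx Lx Lfx.
  have [r' [fr' fxr' ffxr' nfx]] : exists r, [/\ f r = r, adj (f x) r, adj (f (f x)) r
              & forall u, adj (f x) u -> u = f (f x) \/ u = r].
    by apply: (shape_tri sh); rewrite ?(shape_invol sh) // eq_sym.
  rewrite (shape_invol sh) in ffxr' nfx.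
  have {}fr' : r' = r.
    by case: (nx _ ffxr') => // e; rewrite e (shape_invol sh) in fr'; rewrite -fr' eqxx in fx.
  rewrite {}fr' in nfx fxr' ffxr'.
  have dom a b : a != b -> (forall u, adj a u -> u = b \/ u = r) -> (w a r <= w b r)%N ->
      (0 < w a b)%N -> sheds w a b.
    move=> ab na le wab; split=> // j jb; case: (posnP (w a j)) => [->//|/wa/na[e|->//]].
    by rewrite e eqxx in jb.
  case: (leqP (w x r) (w (f x) r)) => le.
    by exists x, (f x); split=> //; apply: dom => //; rewrite eq_sym.
  by exists (f x), x; split=> //; apply: dom => //; [exact: ltnW | rewrite ws].
case: (pickP (fun p : 'I_n * 'I_n => (0 < w p.1 p.2)%N)) => [p|no0]; last first.
  left=> i j; have := no0 (i, j) => /=; by case: (w i j).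
have main i j : f i = i -> f j != j -> (0 < w i j)%N -> ~~ L i /\ sheds w j i.
  move=> fi fj wij; have aij := wa _ _ wij.
  have Li : ~~ L i by apply/negP => /(shape_leaf sh)[]; rewrite fi eqxx.
  split=> //; split; first by rewrite ws.
  have Lj : ~~ L j.
    apply/negP=> Lj; have [_ _ h] := shape_leaf sh Lj.
    have e : i = f j by apply: h; rewrite adj_sym.
    by move: fj; move: fi; rewrite e (shape_invol sh) => <-; rewrite eqxx.
  have Lfj : ~~ L (f j).
    apply/negP=> Lfj; have := wl _ i Lfj; rewrite (shape_invol sh).
    have := noL (f j); rewrite Lfj (shape_invol sh) /= => /negbT; rewrite -eqn0Ngt => /eqP.
    by rewrite [w j i]ws ws => ->; rewrite leqNgt wij.
  have [r [fr jr _ nj]] := shape_tri sh fj Lj Lfj.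
  have ir : i = r.
    case: (nj i) => [|e|//]; first by rewrite adj_sym.
    by move: fj; move: fi; rewrite e (shape_invol sh) => <-; rewrite eqxx.
  move=> k ki; case: (posnP (w j k)) => [->//|wjk].
  case: (nj k (wa _ _ wjk)) => e; last by rewrite e ir eqxx in ki.
  by have := noT j; rewrite fj Lj Lfj -e wjk.
case: p => i j /= wij; right.
have aij := wa _ _ wij.
case: (eqVneq (f i) i) => fi; first by exists j, i; apply: main => //; exact: shape_free aij fi.
case: (eqVneq (f j) j) => fj; first by exists i, j; apply: main; rewrite // ws.
have e := shape_matched sh aij fi fj.
case Li : (L i); first by have := noL i; rewrite Li -e wij.
case Lj : (L j).
  have := noL j; rewrite Lj (_ : f j = i) ?[w j i]ws ?wij //.
  by rewrite e (shape_invol sh).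
by have := noT i; rewrite fi Li -e Lj wij.
Qed.

Theorem bounded_res_cw (K : fieldType) w : cw_weight w -> bounded_res K (cov w).
Proof. by apply: bounded_res_cov => *; [exact: cw_weightP | exact: cw_weight_sheds]. Qed.

Definition edge_weight k : 'I_n -> 'I_n -> nat := fun i j => (k * adj i j)%N.

Lemma cw_weight_edge k : cw_weight (edge_weight k).
Proof.
split=> [i j|i j|v u Lv]; rewrite /edge_weight; first by rewrite adj_sym.
  by case: (adj i j); rewrite ?muln0.
have [fv _ _] := shape_leaf sh Lv.
by rewrite leq_mul2l (adj_sym (f v) v) (shape_mate sh fv) leq_b1 orbT.
Qed.

End Shape.

(** * Maximum induced matchings *)

Section Matching.
Variables (n : nat) (adj : rel 'I_n).
Hypotheses (adj_sym : ssrbool.symmetric adj) (adj_irr : irreflexive adj).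

Lemma edge_pair u v : ([set u; v] \in edges adj) = adj u v.
Proof.
rewrite inE; apply/existsP/idP => [[i /existsP[j /andP[aij /eqP e]]]|a]; last first.
  by exists u; apply/existsP; exists v; rewrite a eqxx.
have ne : i != j by apply: contraTneq aij => ->; rewrite adj_irr.
have : i \in [set u; v] by rewrite e !inE eqxx.
have : j \in [set u; v] by rewrite e !inE eqxx orbT.
have uij : u \in [set i; j] by rewrite -e !inE eqxx.
have vij : v \in [set i; j] by rewrite -e !inE eqxx orbT.
rewrite !inE => /orP[]/eqP ej /orP[]/eqP ei; subst.
- by rewrite eqxx in ne.
- by rewrite adj_sym.
- by [].
- by rewrite eqxx in ne.
Qed.

Lemma matching_add N u v : matching adj N -> adj u v ->
  u \notin cover N -> v \notin cover N ->
  matching adj ([set u; v] |: N) /\ #|[set u; v] |: N| = #|N|.+1.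
Proof.
move=> /andP[sN tN] auv uN vN.
have dis B : B \in N -> [disjoint [set u; v] & B].
  move=> BN; rewrite -setI_eq0; apply/eqP/setP=> x; rewrite !inE.
  apply/negP=> /andP[/orP[]/eqP-> xB].
    by case/negP: uN; apply/bigcupP; exists B.
  by case/negP: vN; apply/bigcupP; exists B.
have N0 : set0 \notin N.
  apply/negP=> /(subsetP sN); rewrite inE => /existsP[i /existsP[j /andP[_ /eqP/setP/(_ i)]]].
  by rewrite !inE eqxx.
have [tN' nN] := trivIsetU1 dis tN N0.
split; last by rewrite cardsU1 nN.
by rewrite /matching tN' subUset sN sub1set edge_pair auv.
Qed.

Variable M : {set {set 'I_n}}.
Hypotheses (indM : induced_matching adj M).
Hypothesis maxM : forall N, matching adj N -> (#|N| <= #|M|)%N.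

Let matM : matching adj M. Proof. by case/andP: indM. Qed.

Definition mate v := odflt v [pick u | [set v; u] \in M].

Lemma pair_adj u v : [set u; v] \in M -> adj u v.
Proof. by case/andP: matM => sM _ /(subsetP sM); rewrite edge_pair. Qed.

Lemma mate_uniq v u u' : [set v; u] \in M -> [set v; u'] \in M -> u = u'.
Proof.
move=> h h'; case/andP: matM => _ /trivIsetP tM.
have ne : u' != v by apply: contraTneq (pair_adj h') => ->; rewrite adj_irr.
case: (eqVneq [set v; u] [set v; u']) => [e|/(tM _ _ h h')].
  have : u' \in [set v; u] by rewrite e !inE eqxx orbT.
  by rewrite !inE (negbTE ne) => /eqP.
by rewrite -setI_eq0 => /eqP/setP/(_ v); rewrite !inE eqxx.
Qed.

Lemma mateP v : mate v != v -> [set v; mate v] \in M.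
Proof. by rewrite /mate; case: pickP => //= _; rewrite eqxx. Qed.

Lemma mate_eq v u : [set v; u] \in M -> mate v = u.
Proof.
move=> h; rewrite /mate; case: pickP => [u' h'|/(_ u)]; last by rewrite h.
exact: mate_uniq h' h.
Qed.

Lemma mate_invol : involutive mate.
Proof.
move=> v; case: (eqVneq (mate v) v) => [e|/mateP]; first by rewrite !e.
by rewrite setUC => /mate_eq.
Qed.

Lemma mem_matching B v : B \in M -> v \in B -> B = [set v; mate v] /\ mate v != v.
Proof.
move=> BM vB; case/andP: matM => /subsetP/(_ _ BM); rewrite inE.
move=> /existsP[i /existsP[j /andP[aij /eqP e]]] _.
have [w ew] : exists w, B = [set v; w].
  by move: vB; rewrite e !inE => /orP[]/eqP->; [exists j | exists i; rewrite setUC].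
rewrite ew in BM *; rewrite (mate_eq BM); split=> //.
by apply: contraTneq (pair_adj BM) => ->; rewrite adj_irr.
Qed.

Lemma cover_matching v : (v \in cover M) = (mate v != v).
Proof.
apply/bigcupP/idP => [[B BM /(mem_matching BM)[]//]|/mateP h].
by exists [set v; mate v]; rewrite // !inE eqxx.
Qed.

Lemma mate_matched u v : adj u v -> mate u != u -> mate v != v -> v = mate u.
Proof.
move=> a /mateP hu /mateP hv; apply/esym/mate_eq.
case/andP: indM => _ /forall_inP/(_ _ hu)/forall_inP/(_ _ hv)/existsPn/(_ [set u; v]).
rewrite in_setD edge_pair a andbT negb_and negbK => /orP[//|].
by case/negP; apply/subsetP=> x; rewrite !inE => /orP[]/eqP->; rewrite eqxx ?orbT.
Qed.

Lemma mate_free u v : adj u v -> mate u = u -> mate v != v.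
Proof.
move=> a fu; apply/negP=> /eqP fv.
have [||/maxM le e] := matching_add matM a; rewrite ?cover_matching ?fu ?fv ?eqxx //.
by rewrite e ltnn in le.
Qed.

(** Otherwise the path [r, x, mate x, r'] would be augmenting. *)
Lemma mate_augment x r r' : mate x != x -> adj x r -> adj (mate x) r' ->
  mate r = r -> mate r' = r' -> r = r'.
Proof.
move=> mx ar ar' fr fr'; apply/eqP/negP=> /negP ne.
have hM := mateP mx; pose N := M :\ [set x; mate x].
have cN v : v \in cover N -> mate v != v /\ v \notin [set x; mate x].
  case/bigcupP=> B; rewrite !inE => /andP[Bne BM] vB.
  have [eB mv] := mem_matching BM vB; split=> //.
  apply: contra Bne => h; rewrite eB; have := mem_matching hM (v := v).
  by rewrite !inE => /(_ h)[-> _].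
have matN : matching adj N.
  case/andP: matM => sM tM; apply/andP; split; last exact: trivIsetS (subD1set _ _) tM.
  exact: subset_trans (subD1set _ _) sM.
have [||mat1 e1] := matching_add matN ar.
- by apply/negP=> /cN[_]; rewrite !inE eqxx.
- by apply/negP=> /cN[]; rewrite fr eqxx.
have cov1 v : v \in cover ([set x; r] |: N) -> v \in [set x; r] \/ v \in cover N.
  case/bigcupP=> B; rewrite !inE => /orP[/eqP->|BN] vB.
    by left; move: vB; rewrite !inE.
  by right; apply/bigcupP; exists B; rewrite ?inE.
have [||/maxM le e2] := matching_add mat1 ar'.
- apply/negP=> /cov1[|/cN[_]]; rewrite !inE ?eqxx ?orbT // => /orP[/eqP e|/eqP e].
    by rewrite e eqxx in mx.
  by move: fr mx; rewrite -e (mate_invol x) => <-; rewrite eqxx.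
- apply/negP=> /cov1[|/cN[]]; rewrite ?fr' ?eqxx // !inE => /orP[/eqP e|/eqP e].
    by rewrite -e fr' eqxx in mx.
  by rewrite e eqxx in ne.
move: le; rewrite e2 e1 /N; have := cardsD1 [set x; mate x] M; rewrite hM add1n => ->.
by rewrite ltnn.
Qed.

Definition isolated_end v := (mate v != v) && [forall u, adj v u ==> (u == mate v)].
(** When both ends of a matched edge have degree one, the order of the vertices
    decides which of them counts as the leaf. *)
Definition leaf v := isolated_end v && (~~ isolated_end (mate v) || (mate v < v)%N).

(** A neighbour of a matched vertex other than its mate is unmatched because the
    matching is induced.  If both ends of a matched edge have such neighbours, all of
    these coincide by [mate_augment], and the edge lies in a triangle. *)
Lemma matching_shape : cw_shape adj mate leaf.
Proof.
have free_nbr v : mate v != v -> ~~ isolated_end v ->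
    exists2 u, adj v u & mate u = u.
  move=> mv; rewrite /isolated_end mv /= => /forallPn[u]; rewrite negb_imply.
  case/andP=> a ne; exists u => //; apply/eqP; apply: contraNT ne => mu.
  exact/eqP/mate_matched.
split.
- exact: mate_invol.
- by move=> v /mateP/pair_adj.
- exact: mate_matched.
- exact: mate_free.
- move=> v /andP[iv Lv]; have /andP[mv /forallP h] := iv; split=> //.
    rewrite /leaf mate_invol iv /=; apply/negP=> /andP[imv lt].
    by move: Lv; rewrite imv /= ltnNge (ltnW lt).
  by move=> u a; apply/eqP; exact: (implyP (h u)).
- move=> v mv Lv Lmv; have mmv : mate (mate v) != mate v by rewrite mate_invol eq_sym.
  have niv : ~~ isolated_end v.
    apply/negP=> iv; move: Lv Lmv; rewrite /leaf iv mate_invol iv /=.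
    rewrite negb_or negbK -leqNgt => /andP[-> le]; rewrite /= -leqNgt => ge.
    by move: mv; rewrite -val_eqE eqn_leq /= le ge.
  have nimv : ~~ isolated_end (mate v).
    apply/negP=> iv; move: Lmv Lv; rewrite /leaf iv mate_invol /=.
    rewrite negb_or negbK -leqNgt => /andP[-> le]; rewrite /= -leqNgt => ge.
    by move: mv; rewrite -val_eqE eqn_leq /= le ge.
  have [r ar fr] := free_nbr _ mv niv; have [r' ar' fr'] := free_nbr _ mmv nimv.
  have e := mate_augment mv ar ar' fr fr'; rewrite -{}e {r'} in ar' fr'.
  exists r; split=> // u au; case: (eqVneq (mate u) u) => mu.
    by right; exact: mate_augment mv au ar' mu fr.
  by left; exact: mate_matched.
Qed.

End Matching.

Theorem cameron_walker_shape n (adj : rel 'I_n) :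
  ssrbool.symmetric adj -> irreflexive adj -> cameron_walker adj ->
  exists f L, cw_shape adj f L.
Proof.
move=> adj_sym adj_irr cw.
have ind0 : induced_matching adj set0.
  apply/andP; split; last by apply/forall_inP=> e; rewrite inE.
  by rewrite /matching sub0set; apply/trivIsetP=> A B; rewrite inE.
have [|M indM eM] := @eq_bigmax_cond _ (mem [pred M | induced_matching adj M]) (fun M => #|M|).
  by apply/card_gt0P; exists set0.
exists (mate M), (leaf adj M); apply: matching_shape => // N mN.
have <- : induced_matching_number adj = #|M| := eM.
rewrite -cw.
exact: (leq_bigmax_cond (F := fun N : {set {set 'I_n}} => #|N|)).
Qed.

(** * The largest degree of a minimal generator *)

Lemma sum_ltn_const k a : (\sum_(t < k) (t < a) = minn a k)%N.
Proof.
elim: k => [|k IH]; first by rewrite big_ord0 minn0.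
by rewrite big_ord_recr /= IH; case: (ltnP k a); lia.
Qed.

Lemma sum_leq_addr k a : (\sum_(t < k) (k <= a + t) = minn a k)%N.
Proof.
rewrite -sum_ltn_const (reindex_inj rev_ord_inj) /=; apply: eq_bigr => t _.
by congr nat_of_bool; have := ltn_ord t; lia.
Qed.

Section Threshold.
Variables (n : nat) (adj : rel 'I_n) (f : 'I_n -> 'I_n) (L : pred 'I_n).
Hypotheses (adj_sym : ssrbool.symmetric adj) (adj_irr : irreflexive adj).
Hypothesis sh : cw_shape adj f L.

Lemma cov_edge k (m : 'X_{1..n}) :
  reflect (forall i j, adj i j -> (k <= m i + m j)%N) (cov (edge_weight adj k) m).
Proof.
apply: (iffP (covP _ _)) => h i j; first by move=> a; have := h i j; rewrite /edge_weight a muln1.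
by rewrite /edge_weight; case a: (adj i j); rewrite ?muln0 // muln1 h.
Qed.

(** Otherwise the exponent of [x_v] could be lowered by one. *)
Lemma mingen_tight k (m : 'X_{1..n}) v : mingen (cov (edge_weight adj k)) m ->
  (0 < m v)%N -> exists2 u, adj v u & (m v + m u = k)%N.
Proof.
move=> /mingenP[/cov_edge cm h] mv; have /negP no := h _ mv.
apply: NNPP => no'; apply/no/cov_edge => i j a; rewrite !mnmBE !mnm1E.
have le := cm _ _ a.
have tight u : adj v u -> (k < m v + m u)%N.
  by move=> au; rewrite ltn_neqAle cm // andbT; apply/negP=> /eqP e; apply: no'; exists u.
case: (eqVneq v i) (a) => [<-|vi]; case: (eqVneq v j) => [<-|vj] //.
- by rewrite adj_irr.
- by move/tight; lia.
- by rewrite adj_sym => /tight; lia.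
by rewrite !subn0.
Qed.

Lemma mingen_le k (m : 'X_{1..n}) v : mingen (cov (edge_weight adj k)) m -> (m v <= k)%N.
Proof.
move=> mm; case: (posnP (m v)) => [->//|/(mingen_tight mm)[u _ <-]].
exact: leq_addr.
Qed.

Lemma tri_mate v r : f v != v -> f r = r -> ~~ L v -> ~~ L (f v) -> adj v r ->
  adj (f v) r /\ forall u, adj v u -> u = f v \/ u = r.
Proof.
move=> fv fr Lv Lfv avr; have [r' [fr' _ ar' nv]] := shape_tri sh fv Lv Lfv.
suff -> : r = r' by [].
case: (nv r avr) => // e; move: fr fv; rewrite e (shape_invol sh) => <-.
by rewrite eqxx.
Qed.

Section Round.
Variables (k : nat) (m : 'X_{1..n}) (t : nat).
Hypotheses (mm : mingen (cov (edge_weight adj k)) m) (tk : (t < k)%N).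

(** The vertex cover obtained from [m] at the threshold [t < k].  On a matched edge
    with a leaf the neighbour of the leaf is taken when its exponent exceeds [t], and
    an unmatched vertex is taken when its exponent is at least [k - t]; a neighbour of
    an unmatched vertex left out has therefore exponent larger than [t].  In a triangle the
    two matched corners are both taken when the apex is left out, and otherwise only
    the smaller of them is. *)
Definition round v : bool :=
  if f v == v then (k <= m v + t)%N
  else if L v then (m (f v) <= t)%N
  else if L (f v) then (t < m v)%N
  else (v < f v)%N || ~~ [exists r, [&& adj v r, f r == r & (k <= m r + t)%N]].

Lemma round_free v : f v = v -> round v = (k <= m v + t)%N.
Proof. by rewrite /round => ->; rewrite eqxx. Qed.

Lemma round_leaf v : L v -> round v = ~~ round (f v).
Proof.
move=> Lv; have [fv Lfv _] := shape_leaf sh Lv.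
rewrite /round (shape_invol sh) (negbTE fv) Lv (negbTE Lfv) eq_sym (negbTE fv).
by rewrite leqNgt.
Qed.

Lemma round_hub v : L (f v) -> round v = (t < m v)%N.
Proof.
move=> Lfv; have := shape_leaf sh Lfv; rewrite (shape_invol sh) => -[fv Lv _].
by rewrite /round eq_sym (negbTE fv) (negbTE Lv) Lfv.
Qed.

Lemma round_tri v r : f v != v -> f r = r -> ~~ L v -> ~~ L (f v) -> adj v r ->
  round v = (v < f v)%N || ~~ round r.
Proof.
move=> fv fr Lv Lfv avr; have [_ nv] := tri_mate fv fr Lv Lfv avr.
rewrite {1}/round (negbTE fv) (negbTE Lv) (negbTE Lfv) round_free //; congr (_ || ~~ _).
apply/existsP/idP => [[r' /and3P[a /eqP fr' le]]|le]; last by exists r; rewrite avr fr eqxx.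
case: (nv _ a) => [e|<-//].
by move: fr' fv; rewrite e (shape_invol sh) => <-; rewrite eqxx.
Qed.

Lemma round_cover u v : adj u v -> round u || round v.
Proof.
suff main x y : f x = x -> f y != y -> adj y x -> round x || round y.
  move=> a; case: (eqVneq (f u) u) => fu.
    by apply: main => //; [exact: (shape_free sh a fu) | rewrite adj_sym].
  case: (eqVneq (f v) v) => fv; first by rewrite orbC; exact: main.
  rewrite (shape_matched sh a fu fv).
  case Lu : (L u); first by rewrite round_leaf // orNb.
  case Lfu : (L (f u)); first by rewrite (round_leaf Lfu) (shape_invol sh) orbN.
  have [r [fr ar afr nr]] := shape_tri sh fu (negbT Lu) (negbT Lfu).
  rewrite (round_tri fu fr) ?Lu ?Lfu //.
  rewrite (@round_tri (f u) r) ?(shape_invol sh) ?Lu ?Lfu //; last by rewrite eq_sym.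
  by have := fu; rewrite -val_eqE neq_ltn orbC => /orP[->|->]; rewrite ?orbT.
move=> fx fy ayx.
have Ly : ~~ L y.
  apply/negP=> /(shape_leaf sh)[_ _ /(_ _ ayx)] e.
  by move: fx fy; rewrite e (shape_invol sh) => <-; rewrite eqxx.
case Lfy : (L (f y)).
  rewrite round_free // round_hub //; case/mingenP: mm => /cov_edge/(_ _ _ ayx) h _.
  by case: (ltnP t (m y)); rewrite ?orbT // orbF; lia.
by rewrite (round_tri fy fx) ?Lfy // orbCA orbN orbT.
Qed.

Lemma round_minimal v : round v -> exists2 u, adj v u & ~~ round u.
Proof.
case: (eqVneq (f v) v) => fv rv.
  have mv : (0 < m v)%N by move: rv; rewrite round_free //; lia.
  have [u a e] := mingen_tight mm mv; have fu := shape_free sh a fv.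
  have auv : adj u v by rewrite adj_sym.
  have Lu : ~~ L u.
    apply/negP=> /(shape_leaf sh)[_ _ /(_ _ auv)] e'.
    by move: fv fu; rewrite e' (shape_invol sh) => <-; rewrite eqxx.
  case Lfu : (L (f u)).
    by exists u => //; rewrite round_hub // -leqNgt; move: rv; rewrite round_free //; lia.
  have [afu nu] := tri_mate fu fv Lu (negbT Lfu) auv.
  have := fu; rewrite -val_eqE neq_ltn => /orP[lt|lt].
    exists u => //; rewrite (round_tri fu fv) ?Lfu // rv orbF -leqNgt; exact: ltnW.
  exists (f u); first by rewrite adj_sym.
  rewrite (@round_tri _ v) ?(shape_invol sh) ?Lfu // ?rv ?orbF -?leqNgt; first exact: ltnW.
  by rewrite eq_sym.
have av := shape_mate sh fv.
case Lv : (L v); first by exists (f v); rewrite // -round_leaf.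
case Lfv : (L (f v)); first by exists (f v); rewrite // round_leaf // (shape_invol sh) rv.
have [r [fr ar afr nr]] := shape_tri sh fv (negbT Lv) (negbT Lfv).
case rr : (round r); last by exists r; rewrite // rr.
exists (f v) => //; move: rv; rewrite (round_tri fv fr) ?Lv ?Lfv // rr orbF => lt.
rewrite (@round_tri _ r) ?(shape_invol sh) ?Lv ?Lfv // ?rr ?orbF -?leqNgt; first exact: ltnW.
by rewrite eq_sym.
Qed.

Lemma mingen_round : mingen (cov (edge_weight adj 1)) [multinom (round v : nat) | v < n].
Proof.
apply/mingenP; split.
  by apply/cov_edge => i j /round_cover; rewrite !mnmE; do 2!case: round.
move=> v; rewrite mnmE lt0b => /round_minimal[u a ru].
apply/negP=> /cov_edge/(_ _ _ a); rewrite !mnmE (negbTE ru) eqxx.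
by case: round; case: eqP.
Qed.

End Round.

(** An unmatched vertex [r] is chosen at exactly [m r] thresholds and one end of an
    edge with a leaf at each of the [k] thresholds, while the matched corners of a
    triangle with apex [r] are chosen [2 * k - m r] times altogether.  By minimality of [m] the
    exponents [m x] and [m y] add up to at most [k] in the former case, and to at most
    [2 * k - m r] in the latter. *)
Theorem mingen_degree k d (m : 'X_{1..n}) :
  (forall m', mingen (cov (edge_weight adj 1)) m' -> (mdeg m' <= d)%N) ->
  mingen (cov (edge_weight adj k)) m -> (mdeg m <= k * d)%N.
Proof.
move=> hd mm; pose s v := (\sum_(t < k) round k m t v)%N.
have sfree v : f v = v -> s v = m v.
  move=> fv; rewrite -[RHS](minn_idPl (mingen_le v mm)) -sum_leq_addr.
  by apply: eq_bigr => t _; rewrite round_free.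
(* Vertices are compared together with their mates; summing over all [v] doubles both
     sides, for unmatched vertices as well. *)
have key v : (m v + m (f v) <= s v + s (f v))%N.
  case: (eqVneq (f v) v) => fv; first by rewrite fv !sfree.
  have leafcase y : L y -> (m y + m (f y) <= s y + s (f y))%N.
    move=> Ly; have [fy Lfy ny] := shape_leaf sh Ly.
    have -> : (s y + s (f y) = k)%N.
      rewrite -big_split /= -[RHS]card_ord -sum1_card; apply: eq_bigr => t _.
      by rewrite round_leaf //; case: round.
    case: (posnP (m y)) => [->|/(mingen_tight mm)[u /ny -> ->//]].
    exact: mingen_le mm.
  case Lv : (L v); first exact: leafcase.
  case Lfv : (L (f v)).
    by have := leafcase _ Lfv; rewrite (shape_invol sh) addnC [X in (_ <= X)%N]addnC.
  have [r [fr ar afr nv]] := shape_tri sh fv (negbT Lv) (negbT Lfv).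
  have ffv : f (f v) != f v by rewrite (shape_invol sh) eq_sym.
  have Lffv : ~~ L (f (f v)) by rewrite (shape_invol sh) Lv.
  have [_ nfv] := tri_mate ffv fr (negbT Lfv) Lffv afr; rewrite (shape_invol sh) in nfv.
  have es : (s v + s (f v) + m r = 2 * k)%N.
    rewrite -(sfree r fr) -!big_split /= mulnC -[in RHS](card_ord k) -sum_nat_const.
    apply: eq_bigr => t _.
    rewrite (round_tri _ _ _ fv fr (negbT Lv) (negbT Lfv) ar).
    rewrite (round_tri _ _ _ ffv fr (negbT Lfv) Lffv afr) (shape_invol sh).
    have := fv; rewrite -val_eqE neq_ltn.
    by case: ltngtP => //; case: round.
  have := mingen_le v mm; have := mingen_le (f v) mm; have := mingen_le r mm.
  have [|/(mingen_tight mm)[u /nv hu eu]] := posnP (m v); first lia.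
  have [|/(mingen_tight mm)[u' /nfv hu' eu']] := posnP (m (f v)); first lia.
  by case: hu => e; case: hu' => e'; rewrite ?e ?e' in eu eu'; lia.
have finj : injective f := inv_inj (shape_invol sh).
have le2 : (mdeg m <= \sum_v s v)%N.
  have : (\sum_v (m v + m (f v)) <= \sum_v (s v + s (f v)))%N by apply: leq_sum => v _; exact: key.
  rewrite !big_split /= -(reindex_inj finj (P := predT) (F := fun v => m v)).
  rewrite -(reindex_inj finj (P := predT) (F := s)) /= -mdegE; lia.
apply: leq_trans le2 _; rewrite /s exchange_big /=.
rewrite -[k in (k * d)%N]card_ord -sum_nat_const; apply: leq_sum => t _.
have := hd _ (mingen_round mm (ltn_ord t)); rewrite mdegE.
by under eq_bigr => v _ do rewrite mnmE.
Qed.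

End Threshold.

(** * Regularity of symbolic powers of cover ideals *)

Section Membership.
Variables (K : fieldType) (n : nat).
Local Notation S := {mpoly K[n]}.

Lemma upset_supportedM (P : pred 'X_{1..n}) (a p : S) :
  upset P -> supported P p -> supported P (a * p).
Proof.
move=> uP hp; apply: (supportedM (A := predT) (B := P)) => // m1 m2 _.
by rewrite addmC; exact: uP.
Qed.

Lemma ideal_span_supported (Q : S -> Prop) (P : pred 'X_{1..n}) p :
  upset P -> (forall g, Q g -> supported P g) -> ideal_span Q p -> supported P p.
Proof.
move=> uP QP [k [a [g [hg ->]]]]; apply: supported_sum => i.
by apply: upset_supportedM => //; exact: QP.
Qed.

Lemma ideal_span_monomials (Q : S -> Prop) p :
  (forall m, m \in msupp p -> exists a g, Q g /\ 'X_[m] = a * g) -> ideal_span Q p.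
Proof.
move=> h; have /fin_all_exists[a /fin_all_exists[g hg]] : forall i : 'I_(size (msupp p)),
    exists a g, Q g /\ 'X_[nth 0%MM (msupp p) i] = a * g.
  by move=> i; apply: h; exact: mem_nth.
exists (size (msupp p)), (fun i : 'I_(size (msupp p)) => p@_(nth 0%MM (msupp p) i) *: a i), g.
split=> [i|]; first by case: (hg i).
rewrite {1}[p]mpolyE (big_nth 0%MM) big_mkord; apply: eq_bigr => i _.
by rewrite -scalerAl; case: (hg i) => _ ->.
Qed.

Lemma mulXU (m : 'X_{1..n}) i : (0 < m i)%N -> 'X_[m] = 'X_[m - U_(i)] * 'X_i :> S.
Proof. by move=> h; rewrite -mpolyXD subU_add. Qed.

Lemma edge_primeP i j p : @edge_prime K n i j p <->
  supported (fun m : 'X_{1..n} => 0 < m i + m j)%N p.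
Proof.
split=> [|h].
  apply: ideal_span_supported => [m m'|g [->|->]]; first by rewrite !mnmDE; lia.
    by apply/supportedX; rewrite mnm1E eqxx.
  by apply/supportedX; rewrite !mnm1E eqxx addn1.
apply: ideal_span_monomials => m /h; rewrite addn_gt0 => /orP[|] /mulXU->.
  by exists 'X_[m - U_(i)], 'X_i; split; first by left.
by exists 'X_[m - U_(j)], 'X_j; split; first by right.
Qed.

Lemma ideal_pow_edge_prime i j k p : i != j ->
  ideal_pow (@edge_prime K n i j) k p <->
  supported (fun m : 'X_{1..n} => k <= m i + m j)%N p.
Proof.
move=> ij; elim: k p => [|k IH] p /=; first by split.
split=> [|h].
  apply: ideal_span_supported => [m m'|_ [f [g [/edge_primeP hf /IH hg ->]]]].
    by rewrite !mnmDE; lia.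
  by apply: (supportedM hf hg) => m1 m2; rewrite !mnmDE; lia.
apply: ideal_span_monomials => m /h hm.
suff [l [ml lij]] : exists l, (0 < m l)%N /\ (l = i \/ l = j).
  exists 1, 'X_[m]; split; last by rewrite mul1r.
  exists 'X_l, 'X_[m - U_(l)]; split; last by rewrite mulrC; exact: mulXU.
    by apply/edge_primeP/supportedX; rewrite !mnm1E; case: lij => ->; rewrite eqxx ?addn1.
  apply/IH/supportedX; rewrite !mnmBE !mnm1E.
  by case: lij ml => -> ml; rewrite eqxx ?[j == i]eq_sym (negbTE ij); lia.
have [mi|mi] := posnP (m i); last by exists i; split; last left.
by exists j; split; [lia | right].
Qed.

Variables (adj : rel 'I_n).
Hypotheses (adj_sym : ssrbool.symmetric adj) (adj_irr : irreflexive adj).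

Lemma cover_ideal_sympowP k p : @cover_ideal_sympow K n adj k p <->
  supported (cov (edge_weight adj k)) p.
Proof.
have ne i j : adj i j -> i != j by move=> a; apply: contraTneq a => ->; rewrite adj_irr.
split=> [h m hm|h i j a].
  by apply/cov_edge => i j a; have /(ideal_pow_edge_prime _ _ (ne _ _ a)) := h i j a; exact.
by apply/(ideal_pow_edge_prime _ _ (ne _ _ a)) => m /h/cov_edge; exact.
Qed.

Lemma cover_idealP p : @cover_ideal K n adj p <-> supported (cov (edge_weight adj 1)) p.
Proof.
split=> [h m hm|h i j a].
  by apply/cov_edge => i j a; have /edge_primeP := h i j a; exact.
by apply/edge_primeP => m /h/cov_edge; exact.
Qed.

Lemma mingen_min (P : pred 'X_{1..n}) m m' :
  upset P -> mingen P m -> P m' -> (m' <= m)%MM -> m' = m.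
Proof.
move=> uP /mingenP[_ h] Pm' /mnm_lepP le; apply/mnmP=> i.
apply/eqP; rewrite eqn_leq le /= leqNgt; apply/negP=> lt.
have /negP := h i (leq_ltn_trans (leq0n _) lt); apply.
rewrite -[X in P X](submK (m := m')); first by rewrite addmC; exact: uP.
apply/mnm_lepP=> j; rewrite mnmBE mnm1E; have := le j.
by case: eqP => [<-|_]; lia.
Qed.

(** The minimal generators of the cover ideal are squarefree, so they occur among
    the finitely many exponents of degree at most [n]. *)
Definition min_covers : seq 'X_{1..n} :=
  [seq val m | m <- enum {: 'X_{1..n < n.+1}} & mingen (cov (edge_weight adj 1)) (val m)].

Lemma mem_min_covers m : (m \in min_covers) = mingen (cov (edge_weight adj 1)) m.
Proof.
apply/mapP/idP => [[b]|h]; first by rewrite mem_filter => /andP[h _] ->.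
have le : (mdeg m < n.+1)%N.
  rewrite ltnS mdegE -[X in (_ <= X)%N]card_ord -sum1_card; apply: leq_sum => i _.
  exact: mingen_le h.
by exists (BMultinom le); rewrite // mem_filter h mem_enum.
Qed.

Lemma monomial_spanP (P : pred 'X_{1..n}) (G : seq 'X_{1..n}) : upset P ->
  (forall m, (m \in G) = mingen P m) -> minimal_monomial_generators (@supported K n P) G.
Proof.
move=> uP hG; split=> [p|m mG].
  split=> [h|].
    apply: ideal_span_monomials => m /h Pm; have [m' gm' le] := mingen_dvd Pm.
    exists 'X_[m - m'], 'X_[m']; split; last by rewrite -mpolyXD submK.
    by exists m'; rewrite // hG.
  apply: ideal_span_supported => // g [m]; rewrite hG => /mingenP[Pm _] ->.
  exact/supportedX.
move=> [k [a [g [hg e]]]].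
have : supported (predC1 m) ('X_[m] : S).
  rewrite e; apply: supported_sum => i; have [m' [m'G ne] ->] := hg i.
  apply: (supportedM (A := predT) (B := pred1 m')) => //.
    by apply/supportedX; exact: eqxx.
  move=> m1 _ _ /eqP->; apply/eqP=> em; apply: ne.
  apply: mingen_min uP _ _ _; first by rewrite -hG.
    by move: m'G; rewrite hG => /mingenP[].
  by rewrite -em lem_addl.
by move/supportedX; rewrite /= eqxx.
Qed.

(** At each vertex of a minimal cover some edge is covered by that vertex alone, and
    stays tight after scaling. *)
Lemma mingen_scale k m : mingen (cov (edge_weight adj 1)) m ->
  mingen (cov (edge_weight adj k)) (m *+ k)%MM.
Proof.
move=> hm; have /mingenP[/cov_edge cm _] := hm; apply/mingenP; split.
  apply/cov_edge=> i j /cm le; rewrite !mulmnE -mulnDl.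
  by rewrite -[X in (X <= _)%N]mul1n leq_mul2r le orbT.
move=> i; rewrite mulmnE muln_gt0 => /andP[mi k0].
have [u a e] := mingen_tight adj_sym adj_irr hm mi.
have ne : i == u = false by apply: contraTF a => /eqP->; rewrite adj_irr.
apply/negP=> /cov_edge/(_ _ _ a); rewrite !mnmBE !mulmnE !mnm1E eqxx ne subn0.
have := congr1 (fun x => x * k)%N e; rewrite mulnDl mul1n.
have : (0 < m i * k)%N by rewrite muln_gt0 mi.
lia.
Qed.

End Membership.

Lemma bigmax_seq_attained (T : eqType) (s : seq T) (F : T -> nat) x : x \in s ->
  exists2 y, y \in s & \max_(z <- s) F z = F y.
Proof.
elim: s x => // a s IH x _; rewrite big_cons.
case: s IH => [|b s] IH; first by exists a; rewrite ?inE // big_nil maxn0.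
have [y ys ->] := IH b (mem_head _ _).
case: (leqP (F a) (F y)) => _; first by exists y; rewrite // inE ys orbT.
by exists a; rewrite ?inE ?eqxx.
Qed.

(** The upper bound comes from comparing a minimal resolution with the bounded one.
    The degree of [m0] is attained in homological degree 0: one of the generators of
    [J] used by the resolution has [m0] in its support, by minimality of [m0]. *)
Theorem has_reg_bounded (K : fieldType) n (P : pred 'X_{1..n}) (J : {mpoly K[n]} -> Prop) m0 :
  upset P -> (forall p, J p <-> supported P p) -> bounded_res K P ->
  mingen P m0 -> (forall m, mingen P m -> (mdeg m <= mdeg m0)%N) ->
  has_reg J (mdeg m0).
Proof.
move=> uP JP [G [gG xG bG]] gm0 max; split; last first.
  move=> i j _ [F [gF xF mF] ->] /eqP; rewrite -lt0n => /card_gt0P[a].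
  rewrite inE => /eqP <-.
  have xG' : fr_exact J G by apply: fr_exact_ext xG => p; rewrite JP.
  have [b <-] := comparison (And3 gF xF mF) gG xG' a.
  have [m /max le leb] := bG _ b.
  rewrite lerBlDr -PoszD lez_nat; exact: leq_trans leb (leq_add le (leqnn i)).
have [F mF] : exists F : free_complex K n, minimal_free_resolution J F.
  apply: minimal_resolution_exists => [|a p q|p e].
  - by apply/JP; exact: supported0.
  - by rewrite !JP => hp hq; apply: supportedD => //; exact: upset_supportedM.
  rewrite !JP => hp m; rewrite mcoeff_msupp mcoeff_mpart.
  by case: ifP => _; rewrite ?eqxx // -mcoeff_msupp; exact: hp.
have [[gF _] [xF _ _] _] := mF.
exists 0%N, (mdeg m0), #|[set a : 'I_(fr_rank F 0) | fr_shift a == mdeg m0]|; split.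
- by exists F.
- apply/eqP; rewrite -lt0n; apply/card_gt0P.
  have /xF[v hv] : J 'X_[m0] by apply/JP/supportedX; case/mingenP: gm0.
  have [a ha] : exists a, m0 \in msupp (v 0 a * fr_aug F a 0).
    apply: NNPP => no; have := mcoeffX K m0 m0; rewrite -hv mxE raddf_sum eqxx big1.
      by move/eqP; rewrite eq_sym oner_eq0.
    by move=> a _; apply: memN_msupp_eq0; apply/negP=> h; apply: no; exists a.
  move/msuppM_le/allpairsP: ha => [[m1 m2] /= [_ hm2 e]].
  have Pm2 : P m2.
    have /JP : J (fr_aug F a 0) by apply/xF; exists (delta_mx 0 a); rewrite -rowE mxE.
    exact.
  have e2 : m2 = m0 by apply: mingen_min Pm2 _; rewrite // e lem_addl.
  by exists a; rewrite inE -(gF _ _ hm2) e2.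
by rewrite subr0.
Qed.

Local Close Scope ring_scope.

Theorem theorem5p4 (K : fieldType) (n : nat) (adj : rel 'I_n)
    (adj_sym : ssrbool.symmetric adj) (adj_irr : irreflexive adj)
    (adj_CW : cameron_walker adj) :
  exists2 d : nat, has_deg (@cover_ideal K n adj) d
    & forall k : nat, (1 <= k)%N ->
        has_reg (@cover_ideal_sympow K n adj k) (Posz (k * d)).
Proof.
have [f [L sh]] := cameron_walker_shape adj_sym adj_irr adj_CW.
have memG := mem_min_covers adj_sym adj_irr.
have [c gc _] : exists2 m, mingen (cov (edge_weight adj 1)) m & (m <= [multinom 1 | _ < n])%MM.
  by apply: mingen_dvd; apply/cov_edge => i j _; rewrite !mnmE.
rewrite -memG in gc; have [m0 Gm0 em0] := bigmax_seq_attained (@mdeg n) gc.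
have max m : mingen (cov (edge_weight adj 1)) m -> mdeg m <= mdeg m0.
  by rewrite -memG -em0 => h; exact: leq_bigmax_seq.
rewrite memG in Gm0; exists (mdeg m0).
  exists (min_covers adj) => //.
  have [gen irr] := monomial_spanP K (@upset_cov _ (edge_weight adj 1)) memG.
  by split=> // p; rewrite cover_idealP.
move=> k _; have gk := mingen_scale adj_sym adj_irr k Gm0.
have ek : mdeg (m0 *+ k)%MM = k * mdeg m0 by rewrite mdegMn mulnC.
rewrite -ek; apply: (has_reg_bounded (P := cov (edge_weight adj k))) => //.
- exact: upset_cov.
- by move=> p; exact: cover_ideal_sympowP.
- exact: (bounded_res_cw adj_sym adj_irr sh K (cw_weight_edge adj_sym sh k)).
move=> m gm; rewrite ek.
exact: (mingen_degree adj_sym adj_irr sh max gm).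
Qed.
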